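(* Let $q\ge 1$ be a fixed integer and let $\alpha_1,\alpha_2,\ldots,\alpha_q$ be positive constants such that $\alpha_1+\alpha_2+\cdots+\alpha_q=1$. Let $\alpha_{\min}=\min\{\alpha_i : i\in[q]\}$. Let $\omega=\omega(n)$ be any function with $\omega(n)\to\infty$ as $n\to\infty$, and let $p=p(n)=\frac{\log n+\omega}{\alpha_{\min}\, n}$, where $p\in[0,1]$. Let $G$ be the random graph $G_{n,p}$, and suppose that the edges of $G$ are independently colored with colors from $C=\{c_1,c_2,\ldots,c_q\}$, where $\mathbb{P}(c(e)=c_i)=\alpha_i$ for each $e\in E(G)$ and $i\in[q]$. Then, with high probability, the following holds simultaneously for all non-negative integers $m_1,m_2,\ldots,m_q$ satisfying $m_1+\cdots+m_q=\lfloor n/2\rfloor$: there exists a perfect matching $M$ of $G$ (that is, a matching with $\lfloor n/2\rfloor$ edges) in which exactly $m_i$ edges are colored with $c_i$, for $i=1,2,\ldots,q$. In other words, with high probability, $$\mathrm{mcp}(G)=\{(m_1,\ldots,m_q)\in\{0,1,\ldots,n\}^q : m_1+\cdots+m_q=\lfloor n/2\rfloor\}.$$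
   Context: $[q]=\{1,\ldots,q\}$, and $\log$ is the natural logarithm. $G_{n,p}$ is the random graph on $n$ vertices in which each of the $\binom{n}{2}$ possible edges is present independently with probability $p$. Here a perfect matching of an $n$-vertex graph means a matching with $\lfloor n/2\rfloor$ edges (so exactly one vertex is left uncovered when $n$ is odd). Given $G$, each edge $e$ receives a random color $c(e)$, independently over edges. For $i\in[q]$, $Q_i=\{e\in E(G): c(e)=c_i\}$ is the $i$-th color class. The perfect matching color profile $\mathrm{mcp}(G)$ of the edge-colored graph $G$ is the set of vectors $(m_1,\ldots,m_q)$ such that there exists a perfect matching $M$ in $G$ with $|Q_i\cap M|=m_i$ for all $i\in[q]$. A sequence of events $E_n$ occurs with high probability if $\mathbb{P}(E_n)\to 1$ as $n\to\infty$; the probability is over both the random graph and the random coloring. *)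

(* Defs.v *)
From HB Require Import structures.
From mathcomp Require Import all_boot all_order all_algebra.
From mathcomp Require Import all_classical all_reals all_analysis.
Set Implicit Arguments.
Unset Strict Implicit.
Unset Printing Implicit Defensive.
Import Order.TTheory GRing.Theory Num.Theory.
Import numFieldNormedType.Exports.

Local Open Scope classical_set_scope.
Local Open Scope ring_scope.

(* The n-choose-2 possible edges on the vertex set 'I_n. *)
Definition vpair (n : nat) := {e : {set 'I_n} | #|e| == 2%N}.

(* A simple graph on 'I_n is its edge set E : {set vpair n}; a coloring is
   defined on the edges of the graph only, not on all of vpair n. *)
Definition coloring (n q : nat) (E : {set vpair n}) : finType :=
  {ffun {e : vpair n | e \in E} -> 'I_q}.

Definition cgraph (n q : nat) := {E : {set vpair n} & coloring q E}.

Definition edges (n q : nat) (G : cgraph n q) : {set vpair n} := tag G.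

Definition edge_color (n q : nat) (G : cgraph n q)
    (e : {e : vpair n | e \in edges G}) : 'I_q :=
  (tagged G : {ffun _ -> _}) e.

Definition color_class (n q : nat) (G : cgraph n q) (i : 'I_q) :
    {set vpair n} :=
  [set val e | e : {e : vpair n | e \in edges G} & edge_color e == i]%SET.

Definition perfect_matching (n q : nat) (G : cgraph n q) (M : {set vpair n}) :
    bool :=
  [&& M \subset edges G, finset.trivIset [set val e | e in M]%SET &
      #|M| == n./2].

Definition mcp (n q : nat) (G : cgraph n q) : set ('I_q -> nat) :=
  [set m | exists M : {set vpair n}, perfect_matching G M /\
           forall i, #|(color_class G i :&: M)%SET| = m i].

Definition gnp (R : realType) (n : nat) (p : R) (E : {set vpair n}) : R :=
  \prod_(e : vpair n) (if e \in E then p else 1 - p).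

Definition coloring_pmf (R : realType) (n q : nat) (alpha : 'I_q -> R)
    (E : {set vpair n}) (c : coloring q E) : R :=
  \prod_(e : {e : vpair n | e \in E}) alpha ((c : {ffun _ -> _}) e).

(* Law of the pair (random graph, random coloring of its edges): first draw the
   graph, then color its edges. *)
Definition cgnp_pmf (R : realType) (n q : nat) (p : R) (alpha : 'I_q -> R)
    (G : cgraph n q) : R :=
  gnp p (edges G) * coloring_pmf alpha (tagged G).

Definition cgnp_prob (R : realType) (n q : nat) (p : R) (alpha : 'I_q -> R)
    (A : set (cgraph n q)) : R :=
  \sum_(G : cgraph n q | G \in A) cgnp_pmf p alpha G.

Lemma gnp_sum (R : realType) n (p : R) : \sum_(E : {set vpair n}) gnp p E = 1.
Proof.
have h := @bigA_distr R 0 1 *%R +%R (vpair n) (fun=> p) (fun=> 1 - p).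
rewrite big1 in h; last by move=> *; rewrite -[LHS]/(p + (1 - p)) addrC subrK.
by rewrite h; apply: eq_big => // E; rewrite ?inE.
Qed.

Lemma cgnp_prob_setT (R : realType) n q (p : R) (alpha : 'I_q -> R) :
  \sum_(i < q) alpha i = 1 -> cgnp_prob p alpha [set: cgraph n q] = 1.
Proof.
move=> a1; rewrite /cgnp_prob.
transitivity (\sum_(E : {set vpair n}) \sum_(c : coloring q E) gnp p E * coloring_pmf alpha c).
  rewrite sig_big_dep /=.
  by apply: eq_big => -[E c] //=; rewrite in_setT.
rewrite -[RHS](gnp_sum n p); apply: eq_bigr => E _.
rewrite -mulr_sumr -[RHS]mulr1; congr (_ * _).
rewrite /coloring_pmf.
rewrite -(bigA_distr_bigA (fun (e : {e : vpair n | e \in E}) i => alpha i)).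
by rewrite big1.
Qed.

(* The default value 1 is harmless when the alpha i are positive with sum 1; see
   alpha_min_attained. *)
Definition alpha_min (R : realType) (q : nat) (alpha : 'I_q -> R) : R :=
  \big[Num.min/1]_(i < q) alpha i.

Lemma alpha_min_le (R : realType) q (alpha : 'I_q -> R) i : alpha_min alpha <= alpha i.
Proof. exact: bigmin_le_cond. Qed.

Lemma alpha_min_attained (R : realType) q (alpha : 'I_q -> R) : (1 <= q)%N ->
  (forall i, 0 < alpha i) -> \sum_(i < q) alpha i = 1 -> exists i, alpha_min alpha = alpha i.
Proof.
case: q alpha => // q alpha _ a0 a1.
have le1 i : alpha i <= 1.
  by rewrite -a1 (bigD1 i) //= lerDl sumr_ge0 // => j _; exact: ltW.
rewrite /alpha_min.
rewrite (@bigmin_eq_arg _ R 'I_q.+1 1 ord0 xpredT alpha isT (fun i _ => le1 i)).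
by eexists.
Qed.

(* Main.v *)
(** Each colour class is distributed as G(n, alpha_i p), of average degree d >=
    log n + omega. With high probability it has no isolated vertex, its maximum
    degree is O(d), the vertices of degree at most d/16 are far apart, any two
    sets of linear size are joined by an edge, and small sets expand. Given
    these properties of all colour classes, let i be the colour with the largest
    m_i. Match the small-degree vertices in colour i. By the local lemma the
    vertices can be labelled with boundedly many labels so that every vertex of
    large degree in colour i has a positive fraction of its colour-i neighbours
    in each label class; put aside two small classes X and Y. Outside X and Y
    pick the edges of the other colours greedily. The uncovered vertices split
    into two parts of almost equal size containing X and Y respectively, and
    Hall's condition for colour i holds between these parts: for small sets by
    expansion into X or Y, for large sets because two large sets are joined by
    an edge. *)

Require Import Defs.
From HB Require Import structures.
From mathcomp Require Import all_boot all_order all_algebra.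
From mathcomp Require Import all_classical all_reals all_analysis.
From mathcomp Require Import fintype finset zify ring lra.
Import Order.TTheory GRing.Theory Num.Theory.
Import numFieldNormedType.Exports.
Set Implicit Arguments.
Unset Strict Implicit.
Unset Printing Implicit Defensive.

(** * Hall's theorem and the local lemma *)

(** The function omega may grow arbitrarily slowly, so the rarest colour class may contain vertices
    of very small degree. Such a vertex may have no neighbour in a small reservoir, which is why
    these vertices are matched before anything else. Even for the other vertices a union bound is
    too weak: a given vertex misses a reservoir with probability exp(- t d) for some t far below 1,
    while n can be nearly exp(d). The local lemma compares this probability only with the square of
    the maximum degree, which is O(d^2). The properties required of the colour classes do not
    mention the m_i. Everything after them is deterministic, and all profiles are obtained at once.
    The colour with the largest m_i has at least floor(n/2)/q edges; this linear amount absorbs the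
    small-degree vertices, X and Y, whose sizes are kept below suitable multiples of n/q. Colours
    with alpha_i above the minimum only have a larger d, so one estimate of the form const/omega
    serves all of them. *)

Lemma hall_marriage (T T' : finType) (N : T -> {set T'}) (A : {set T}) :
  (forall S : {set T}, S \subset A -> #|S| <= #|\bigcup_(x in S) N x|) ->
  exists f : T -> option T', {in A &, injective f} /\
    (forall x, x \in A -> exists2 y, f x = Some y & y \in N x).
Proof.
have [m] := ubnP #|A|; elim: m A N => // m IHm A N ltAm hallA.
have [->|[x0 x0A]] := set_0Vmem A.
  by exists (fun=> None); split=> [x y|x]; rewrite inE.
(* If some nonempty proper subset B is tight, B is matched into its neighbourhood and the rest of A
   outside it. Hall's condition for a set S of the rest follows from that for S together with B. *)
have [/existsP[B /and3P[sBA B0 /eqP cB]]|noB] := boolP [exists B : {set T},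
   [&& B \proper A, B != set0 & #|\bigcup_(x in B) N x| == #|B|]].
  have [|S sSB|f [injf fN]] := IHm B N.
  - by apply: leq_trans (proper_card sBA) _.
  - by apply: hallA; apply: subset_trans sSB (proper_sub sBA).
  set NB := \bigcup_(x in B) N x.
  have [|S sSA|g [injg gN]] := IHm (A :\: B) (fun x => N x :\: NB).
  - apply: leq_trans (_ : #|A| <= m) => //; rewrite cardsD ltn_subrL.
    rewrite (setIidPr (proper_sub sBA)) card_gt0 B0.
    by apply: leq_trans (proper_card sBA).
  - have dSB : S :&: B = set0.
      apply/eqP; rewrite setI_eq0; have := sSA; rewrite subsetD => /andP[_ //].
    have := hallA (S :|: B); rewrite subUset (proper_sub sBA) andbT.
    rewrite (subset_trans sSA (subsetDl _ _)) => /(_ isT).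
    rewrite bigcup_setU -/NB cardsU dSB cards0 subn0 -cB -/NB.
    have -> : \bigcup_(x in S) (N x :\: NB) = (\bigcup_(x in S) N x) :\: NB.
      apply/setP=> y; rewrite inE; apply/bigcupP/andP.
        by case=> x xS; rewrite inE => /andP[-> ?]; split=> //; apply/bigcupP; exists x.
      by case=> yNB /bigcupP[x xS yx]; exists x => //; rewrite inE yNB.
    have := cardsU (\bigcup_(x in S) N x) NB; have := cardsID NB (\bigcup_(x in S) N x).
    by lia.
  exists (fun x => if x \in B then f x else g x); split=> [x y xA yA|x xA]; last first.
    case: ifPn => xB; first exact: fN.
    by have [|y gy] := gN x; [rewrite inE xB | rewrite inE => /andP[_]; exists y].
  case: ifPn => xB; case: ifPn => yB; first exact: injf.
  - have [|z gz] := gN y; first by rewrite inE yB.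
    rewrite inE => /andP[zN _] fx; have [w fw wN] := fN _ xB.
    case/negP: zN; apply/bigcupP; exists x => //.
    by move: fx; rewrite gz fw => -[<-].
  - have [|z gz] := gN x; first by rewrite inE xB.
    rewrite inE => /andP[zN _] fx; have [w fw wN] := fN _ yB.
    case/negP: zN; apply/bigcupP; exists y => //.
    by move: fx; rewrite gz fw => -[->].
  - by apply: injg; rewrite inE ?xB ?yB.
(* Without a tight set, every nonempty proper subset has a surplus neighbour, so any neighbour y0
   may be given to x0. *)
have [y0 y0N] : exists y, y \in N x0.
  apply/set0Pn; rewrite -card_gt0.
  by have := hallA [set x0]; rewrite sub1set x0A big_set1 cards1 => /(_ isT).
have [|S sSA|g [injg gN]] := IHm (A :\ x0) (fun x => N x :\ y0).
- by have := cardsD1 x0 A; rewrite x0A; lia.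
- have [->|S0] := eqVneq S set0; first by rewrite cards0.
  have pSA : S \proper A by apply: sub_proper_trans sSA (properD1 x0A).
  have ltS : #|S| < #|\bigcup_(x in S) N x|.
    rewrite ltn_neqAle hallA ?(proper_sub pSA) // andbT eq_sym.
    by apply: contraNN noB => cS; apply/existsP; exists S; rewrite pSA S0.
  have -> : \bigcup_(x in S) (N x :\ y0) = (\bigcup_(x in S) N x) :\ y0.
    apply/setP=> y; rewrite !inE; apply/bigcupP/andP.
      by case=> x xS; rewrite !inE => /andP[-> ?]; split=> //; apply/bigcupP; exists x.
    by case=> yNB /bigcupP[x xS yx]; exists x => //; rewrite !inE yNB.
  by have := cardsD1 y0 (\bigcup_(x in S) N x); lia.
exists (fun x => if x == x0 then Some y0 else g x); split=> [x y xA yA|x xA]; last first.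
  case: eqP => [->|/eqP xx0]; first by exists y0.
  by have [|y gy] := gN x; [rewrite !inE xx0 | rewrite !inE => /andP[_]; exists y].
case: eqP => [->|/eqP xx0]; case: eqP => [->|/eqP yx0] //.
- by have [|z ->] := gN y; rewrite !inE ?yx0 // => /andP[/eqP zy _] [?]; case: zy.
- by have [|z ->] := gN x; rewrite !inE ?xx0 // => /andP[/eqP zy _] [?]; case: zy.
- by apply: injg; rewrite !inE ?xx0 ?yx0.
Qed.

(** * The symmetric local lemma for uniform labellings *)

Section LLL.
Variables (V L : finType).
Notation Om := {ffun V -> L}.
(** Events are finite sets of labellings and probabilities are ratios of cardinalities, so the whole
    argument stays within integer inequalities. *)
Definition determined (N : {set V}) (A : {set Om}) :=
  forall f g : Om, {in N, f =1 g} -> (f \in A) = (g \in A).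

(* Exchanging the N-coordinates of two labellings is an involution of Om x Om that
   maps (A :&: B) x Om onto A x B. *)
Lemma determined_indep (N : {set V}) (A B : {set Om}) :
  determined N A -> determined (~: N) B -> #|A :&: B| * #|Om| = #|A| * #|B|.
Proof.
move=> dA dB.
pose mix (f g : Om) : Om := [ffun x => if x \in N then f x else g x].
pose h (u : Om * Om) := (mix u.1 u.2, mix u.2 u.1).
have hK : involutive h.
  by case=> f g; rewrite /h /=; congr pair; apply/ffunP=> x; rewrite !ffunE; case: (x \in N).
rewrite -cardsT -!cardsX.
have -> : setX (A :&: B) [set: Om] = h @^-1: setX A B.
  apply/setP=> -[f g]; rewrite !inE /= andbT; congr (_ && _).
    by apply: dA => x xN; rewrite ffunE xN.
  by apply: dB => x; rewrite inE ffunE => /negPf ->.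
by rewrite on_card_preimset //; apply: onW_bij; exists h.
Qed.

Variables (N : V -> {set V}) (A : V -> {set Om}) (D : nat).
Hypothesis dA : forall v, determined (N v) (A v).
Hypothesis D0 : 0 < D.
Hypothesis degD : forall v, #|[set w | w != v & N w :&: N v != set0]| <= D.
Hypothesis smallA : forall v, 4 * D * #|A v| <= #|Om|.

Let C (S : {set V}) := [set f | [forall w in S, f \notin A w]].

Let inC (S : {set V}) f : (f \in C S) = [forall w in S, f \notin A w]. Proof. by rewrite inE. Qed.

(* P(A v | C S) <= 1 / (2 D), by induction on S, splitting S into the events that
   share a coordinate with A v (at most D of them) and those independent of A v. *)
Let lll_step (S : {set V}) v : v \notin S -> 2 * D * #|A v :&: C S| <= #|C S|.
Proof.
have [m] := ubnP #|S|; elim: m S v => // m IHm S v ltSm vS.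
pose S1 := [set w in S | N w :&: N v != set0]; pose S2 := S :\: S1.
have S12 : S1 \subset S by apply/subsetP=> w; rewrite inE => /andP[].
have cS1 : #|S1| <= D.
  apply: leq_trans (degD v); apply/subset_leq_card/subsetP=> w; rewrite !inE.
  by case/andP=> wS ->; rewrite andbT; apply: contraNneq vS => <-.
have dC : determined (~: N v) (C S2).
  move=> f g fg; rewrite !inC; apply: eq_forallb => w.
  case wS2: (w \in S2) => //=; congr (~~ _).
  apply: dA => x xw; apply: fg; rewrite inE; apply: contraTN wS2 => xv.
  rewrite !inE negb_and; apply/orP.
  case: (w \in S); last by right.
  by left; rewrite negbK; apply/set0Pn; exists x; rewrite inE xw.
have ind := determined_indep (@dA v) dC.
have Om0 : 0 < #|Om| \/ #|Om| = 0 by lia.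
have bndC2 : 4 * D * #|A v :&: C S2| <= #|C S2|.
  case: Om0 => [Om0|Om0]; last first.
    have := subset_leq_card (subsetT (A v :&: C S2)); rewrite cardsT Om0; lia.
  rewrite -(leq_pmul2r Om0) -mulnA ind mulnA mulnC leq_mul2l.
  by rewrite smallA orbT.
(* Given [C S2], each of the at most D events indexed by S1 has probability at most 1/(2D) by
   induction, so together they remove at most half. Combined with [bndC2], the bound 1/(4D) becomes
   1/(2D). *)
have half : #|C S2| <= 2 * #|C S|.
  have [S1e|S1n] := eqVneq S1 set0; first by rewrite /S2 S1e setD0; lia.
  have ltS2 : #|S2| < m.
    apply: leq_trans (_ : #|S| <= m) => //.
    have := cardsID S1 S; rewrite (setIidPr S12) -/S2.
    have : 0 < #|S1| by rewrite card_gt0.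
    by lia.
  have sub : C S2 \subset C S :|: \bigcup_(w in S1) (A w :&: C S2).
    apply/subsetP=> f fC2; rewrite inE; apply/orP.
    have [|fC] := boolP (f \in C S); [by left | right].
    move: fC; rewrite inC => /forall_inPn[w wS]; rewrite negbK => fw.
    apply/bigcupP; exists w; last by rewrite inE fw.
    apply: contraT => wS1; have wS2 : w \in S2 by rewrite inE wS1.
    by move: fC2; rewrite inC => /forall_inP/(_ w wS2); rewrite fw.
  have := leq_trans (subset_leq_card sub) (leq_card_setU _ _).
  have le1 : #|\bigcup_(w in S1) (A w :&: C S2)| <= \sum_(w in S1) #|A w :&: C S2|.
    elim/big_rec2: _ => [|w y B _ le]; first by rewrite cards0.
    by apply: leq_trans (leq_card_setU _ _) _; rewrite leq_add2l.
  have : 2 * D * \sum_(w in S1) #|A w :&: C S2| <= #|S1| * #|C S2|.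
    rewrite big_distrr /= -sum_nat_const; apply: leq_sum => w wS1.
    by apply: IHm => //; rewrite !inE negb_and; move: wS1; rewrite !inE => ->.
  by move: le1 cS1; nia.
have : #|A v :&: C S| <= #|A v :&: C S2|.
  apply/subset_leq_card/setIS/subsetP=> f; rewrite !inC => /forall_inP fS.
  by apply/forall_inP=> w; rewrite inE => /andP[_]; apply: fS.
by move: bndC2 half; nia.
Qed.

(** By [lll_step], adding one index to S removes at most half of [C S], so no [C S] is ever
    empty. *)
Lemma local_lemma : 0 < #|L| -> exists f : Om, forall v, f \notin A v.
Proof.
move=> L0.
have C0 (S : {set V}) : 0 < #|C S|.
  have [m] := ubnP #|S|; elim: m S => // m IHm S ltSm.
  have [->|[v vS]] := set_0Vmem S.
    have [l _] := card_gt0P L0.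
    by apply/card_gt0P; exists [ffun=> l]; rewrite inC; apply/forall_inP=> w; rewrite inE.
  have := @lll_step (S :\ v) v; rewrite !inE eqxx => /(_ isT).
  have := IHm (S :\ v); have := cardsD1 v S; rewrite vS.
  have : #|C (S :\ v)| <= #|C S| + #|A v :&: C (S :\ v)|.
    apply: leq_trans (leq_card_setU _ _).
    apply/subset_leq_card/subsetP=> f fC; rewrite !in_setU in_setI fC andbT.
    rewrite orbC; case: (boolP (f \in A v)) => //= fA.
    rewrite inC; apply/forall_inP=> w wS.
    have [->//|wv] := eqVneq w v.
    by move: fC; rewrite inC => /forall_inP/(_ w); apply; rewrite !inE wv.
  by nia.
have [f] := card_gt0P (C0 setT).
by rewrite inC => /forall_inP fC; exists f => v; apply: fC; rewrite inE.
Qed.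
End LLL.

(** * Labellings that split every large neighbourhood *)

Section Splitting.
Local Open Scope ring_scope.
Variables (R : realFieldType) (V : finType).

(* Markov's inequality for 2 ^ - #{u in N | f u = j} *)
Lemma few_labels_card k (N : {set V}) (j : 'I_k) b :
  #|[set f : {ffun V -> 'I_k} | (#|[set u in N | f u == j]| < b)%N]|%:R <=
    2 ^+ b * (1 - (2 * k)%:R^-1) ^+ #|N| * #|{ffun V -> 'I_k}|%:R :> R.
Proof.
have k_gt0 : (0 < k)%N := leq_ltn_trans (leq0n j) (ltn_ord j).
have k0 : k%:R != 0 :> R by rewrite pnatr_eq0 -lt0n.
pose w (f : {ffun V -> 'I_k}) : R := \prod_u (if (u \in N) && (f u == j) then 2^-1 else 1).
have wE f : w f = 2^-1 ^+ #|[set u in N | f u == j]|.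
  rewrite /w -big_mkcond /= prodr_const; congr (_ ^+ _).
  by apply: eq_card => u; rewrite inE.
have sumw : \sum_f w f = (1 - (2 * k)%:R^-1) ^+ #|N| * #|{ffun V -> 'I_k}|%:R.
  rewrite /w -(bigA_distr_bigA (fun u i => if (u \in N) && (i == j) then 2^-1 else 1)).
  transitivity (\prod_(u : V) ((if u \in N then (1 - (2 * k)%:R^-1) else 1) * k%:R : R)).
    apply: eq_bigr => u _; case: (u \in N) => /=.
      rewrite (bigD1 j) //= eqxx (eq_bigr (fun=> 1)); last by move=> i /negPf ->.
      rewrite sumr_const cardC1 card_ord.
      by rewrite -subn1 natrB // natrM; field.
    by rewrite sumr_const card_ord mul1r.
  rewrite big_split /= prodr_const card_ffun card_ord natrX -big_mkcond /= prodr_const.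
  by [].
rewrite -mulrA -sumw -sum1dep_card natr_sum mulr_sumr big_mkcond /=.
apply: ler_sum => f _; rewrite wE exprVn; case: ifP => [lt|_].
  by rewrite ler_pdivlMr ?exprn_gt0 // mul1r; apply: ler_weXn2l (ltnW lt); lra.
by rewrite divr_ge0 ?exprn_ge0.
Qed.


(** The bad event at v is that some label occurs fewer than b times on [N v]; it is taken empty when
    v has degree below a. It depends only on the labels on [N v], so it meets at most Dl^2 others,
    those of vertices sharing a neighbour with v. The numerical hypothesis is the local lemma
    condition: k labels, the Markov bound for each, and the factor 4 Dl^2. *)
Lemma split_labels k (N : V -> {set V}) (a b Dl : nat) : (0 < k)%N -> (0 < Dl)%N ->
  (forall u v, (u \in N v) = (v \in N u)) ->
  (forall v, #|N v| <= Dl)%N ->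
  k%:R * 2 ^+ b * (1 - (2 * k)%:R^-1) ^+ a * (4 * Dl ^ 2)%:R <= 1 :> R ->
  exists f : {ffun V -> 'I_k}, forall v, (a <= #|N v|)%N ->
    forall j, (b <= #|[set u in N v | f u == j]|)%N.
Proof.
move=> k0 Dl0 symN degN le1.
pose B v j := [set f : {ffun V -> 'I_k} | (#|[set u in N v | f u == j]| < b)%N].
pose A v := if (a <= #|N v|)%N then \bigcup_j B v j else set0.
have dA v : determined (N v) (A v).
  move=> f g fg; rewrite /A; case: ifP => _; last by rewrite !inE.
  have eqj j : (f \in B v j) = (g \in B v j).
    rewrite !inE; congr (_ < _)%N; apply: eq_card => u; rewrite !inE.
    by case uN: (u \in N v) => //=; rewrite fg.
  by apply/bigcupP/bigcupP => -[j _ fj]; exists j => //; rewrite ?eqj // -eqj.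
have degD v : (#|[set w | w != v & N w :&: N v != set0]| <= Dl ^ 2)%N.
  apply: leq_trans (_ : #|\bigcup_(x in N v) N x| <= _)%N.
    apply/subset_leq_card/subsetP=> w; rewrite inE => /andP[_ /set0Pn[x]].
    by rewrite inE => /andP[xw xv]; apply/bigcupP; exists x => //; rewrite symN.
  apply: leq_trans (_ : \sum_(x in N v) #|N x| <= _)%N.
    elim/big_rec2: _ => [|x y C _ le]; first by rewrite cards0.
    by apply: leq_trans (leq_card_setU _ _) _; rewrite leq_add2l.
  apply: leq_trans (_ : \sum_(x in N v) Dl <= _)%N; first exact: leq_sum.
  by rewrite sum_nat_const leq_mul2r degN orbT.
have smallA v : (4 * Dl ^ 2 * #|A v| <= #|{ffun V -> 'I_k}|)%N.
  rewrite /A; case: ifP => [av|_]; last by rewrite cards0 muln0.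
  rewrite -(ler_nat R) natrM.
  have cU : #|\bigcup_j B v j|%:R <= \sum_j #|B v j|%:R :> R.
    rewrite -natr_sum ler_nat; elim/big_rec2: _ => [|x y C _ le]; first by rewrite cards0.
    by apply: leq_trans (leq_card_setU _ _) _; rewrite leq_add2l.
  have r01 : 0 <= (1 - (2 * k)%:R^-1 : R) <= 1.
    rewrite lerBlDr lerDl invr_ge0 ler0n andbT subr_ge0 invf_le1 ?ltr0n ?muln_gt0 //.
    by rewrite ler1n muln_gt0.
  have cB j : #|B v j|%:R <= 2 ^+ b * (1 - (2 * k)%:R^-1) ^+ a * #|{ffun V -> 'I_k}|%:R :> R.
    apply: le_trans (few_labels_card _ _ _) _.
    rewrite ler_wpM2r // ler_wpM2l ?exprn_ge0 //.
    by case/andP: r01 => r0 r1; apply: ler_wiXn2l.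
  have : \sum_j #|B v j|%:R <= k%:R * (2 ^+ b * (1 - (2 * k)%:R^-1) ^+ a * #|{ffun V -> 'I_k}|%:R) :> R.
    apply: le_trans (ler_sum _ (fun j _ => cB j)) _.
    by rewrite sumr_const card_ord mulr_natl.
  move=> /(le_trans cU) cU'.
  apply: le_trans (ler_wpM2l (ler0n _ _) cU') _.
  move: le1 => /(ler_wpM2r (ler0n R #|{ffun V -> 'I_k}|)); rewrite mul1r.
  by apply: le_trans; rewrite le_eqVlt; apply/orP; left; apply/eqP; ring.
have [||f fA] := local_lemma dA _ degD smallA; first by rewrite expn_gt0 Dl0.
  by rewrite card_ord.
exists f => v av j; have := fA v; rewrite /A av; apply: contraR; rewrite -ltnNge => lt.
by apply/bigcupP; exists j => //; rewrite inE.
Qed.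

End Splitting.

(** * Matchings of a graph and of its colour classes *)

Section Matchings.
Variable n : nat.
Implicit Types (E M : {set vpair n}) (u v : 'I_n) (S T X Y U : {set 'I_n}).

Definition adj E u v := [exists e in E, val e == [set u; v]].
Definition nbr E u := [set v | adj E u v].
Definition cov M := \bigcup_(e in M) val e.
Definition matching M := {in M &, forall e f : vpair n, e != f -> [disjoint val e & val f]}.

Lemma adjP E u v : reflect (exists2 e, e \in E & val e = [set u; v]) (adj E u v).
Proof.
apply: (iffP existsP) => [[e /andP[eE /eqP eq]]|[e eE eq]]; exists e => //.
by rewrite eE eq eqxx.
Qed.

Lemma adj_sym E u v : adj E u v = adj E v u.
Proof. by rewrite /adj; apply: eq_existsb => e; rewrite setUC. Qed.

Lemma adj_neq E u v : adj E u v -> u != v.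
Proof.
case/adjP=> e _ eq; apply/eqP=> uv; have := eqP (valP e).
by rewrite eq uv setUid cards1.
Qed.

Lemma in_nbr E u v : (v \in nbr E u) = adj E u v. Proof. by rewrite inE. Qed.

Lemma nbr_sym E u v : (u \in nbr E v) = (v \in nbr E u).
Proof. by rewrite !in_nbr adj_sym. Qed.

Lemma matchingU M1 M2 : matching M1 -> matching M2 -> [disjoint cov M1 & cov M2] ->
  matching (M1 :|: M2).
Proof.
move=> m1 m2 dis e f; have disef e' f' : e' \in M1 -> f' \in M2 -> [disjoint val e' & val f'].
  move=> e1 f2; apply: disjointWl (bigcup_sup e' e1) _.
  exact: disjointWr (bigcup_sup f' f2) dis.
rewrite !inE => /orP[e1|e2] /orP[f1|f2] ef; [exact: m1|exact: disef| |exact: m2].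
by rewrite disjoint_sym disef.
Qed.

Lemma covU M1 M2 : cov (M1 :|: M2) = cov M1 :|: cov M2.
Proof. exact: bigcup_setU. Qed.

Lemma cov1 (e : vpair n) : cov [set e] = val e.
Proof. exact: big_set1. Qed.

Lemma matching1 (e : vpair n) : matching [set e].
Proof. by move=> x y; rewrite !inE => /eqP-> /eqP->; rewrite eqxx. Qed.

Lemma card_matchingU M1 M2 : [disjoint cov M1 & cov M2] -> #|M1 :|: M2| = #|M1| + #|M2|.
Proof.
move=> dis; rewrite cardsU; have -> : M1 :&: M2 = set0; last by rewrite cards0 subn0.
apply/setP=> e; rewrite !inE; apply/negP=> /andP[e1 e2].
have [x xe] : exists x, x \in val e by apply/card_gt0P; rewrite (eqP (valP e)).
have := disjointFr dis (x := x); rewrite (subsetP (bigcup_sup e e1)) //.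
by rewrite (subsetP (bigcup_sup e e2)) // => /(_ isT).
Qed.

Lemma card_cov M : matching M -> #|cov M| = 2 * #|M|.
Proof.
have [m] := ubnP #|M|; elim: m M => // m IHm M ltM mM.
have [->|[e eM]] := set_0Vmem M; first by rewrite /cov big_set0 !cards0.
rewrite -(setD1K eM) covU cov1 cardsU.
have dis : val e :&: cov (M :\ e) = set0.
  apply/eqP; rewrite setI_eq0; apply/bigcup_disjoint=> f; rewrite !inE => /andP[fe fM].
  by rewrite mM // eq_sym.
have mM' : matching (M :\ e).
  by move=> x y; rewrite !inE => /andP[_ xM] /andP[_ yM]; apply: mM.
have cM := cardsD1 e M; rewrite eM in cM.
rewrite dis cards0 subn0 IHm //; last by lia.
by rewrite cardsU1 !inE eqxx (eqP (valP e)); lia.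
Qed.

Lemma matching_of_fun E (f : 'I_n -> 'I_n) X :
  {in X &, injective f} -> (forall x, x \in X -> adj E x (f x)) ->
  (forall x, x \in X -> f x \notin X) ->
  exists2 M : {set vpair n}, M \subset E & [/\ matching M, #|M| = #|X| & cov M = X :|: f @: X].
Proof.
have [m] := ubnP #|X|; elim: m X => // m IHm X ltX injf adjf fX.
have [->|[x xX]] := set_0Vmem X.
  exists set0; rewrite ?sub0set // imset0 setU0 /cov big_set0 !cards0.
  by split=> // e; rewrite inE.
have cX := cardsD1 x X; rewrite xX in cX.
have [||||M sME [mM cM covM]] := IHm (X :\ x); first by lia.
- by move=> y z; rewrite !inE => /andP[_ yX] /andP[_ zX]; apply: injf.
- by move=> y; rewrite inE => /andP[_]; apply: adjf.
- by move=> y; rewrite !inE => /andP[_] /fX /negPf ->; rewrite andbF.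
have [e eE ve] := adjP _ _ _ (adjf x xX).
have dis : [disjoint cov [set e] & cov M].
  rewrite cov1 ve covM disjoints_subset; apply/subsetP=> y; rewrite !inE => /orP[]/eqP->.
    rewrite eqxx /=; apply/imsetP=> -[z]; rewrite !inE => /andP[_ zX] xz.
    by have := fX z zX; rewrite -xz xX.
  rewrite (negPf (fX x xX)) andbF /=; apply/imsetP=> -[z]; rewrite !inE => /andP[zx zX] xz.
  by move: zx; rewrite (injf _ _ xX zX xz) eqxx.
exists ([set e] :|: M); first by rewrite subUset sub1set eE.
rewrite card_matchingU // cards1 cM cX covU cov1 covM ve; split=> //.
  by apply: matchingU => //; apply: matching1.
rewrite -{3 4}(setD1K xX) imsetU1; apply/setP=> y; rewrite !inE.
by case: (y == x); case: (y == f x); rewrite ?orbT.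
Qed.

Lemma hall_matching E X Y : [disjoint X & Y] ->
  (forall S : {set 'I_n}, S \subset X -> #|S| <= #|[set v in Y | [exists u in S, adj E u v]]|) ->
  exists2 M : {set vpair n}, M \subset E & [/\ matching M, #|M| = #|X| & cov M \subset X :|: Y].
Proof.
move=> dXY hallX; have [|g [injg gN]] := @hall_marriage _ _ (fun u => nbr E u :&: Y) X.
  move=> S sSX; apply: leq_trans (hallX S sSX) _; apply/subset_leq_card/subsetP=> v.
  rewrite inE => /andP[vY /existsP[u /andP[uS uv]]].
  by apply/bigcupP; exists u => //; rewrite !inE uv.
pose f u := odflt u (g u).
have fE u : u \in X -> [/\ g u = Some (f u), adj E u (f u) & f u \in Y].
  by move=> /gN[v gu]; rewrite /f gu !inE => /andP[].
have [||u uX|M sM [mM cM covM]] := @matching_of_fun E f X.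
- move=> u v uX vX fuv; apply: injg => //.
  by have [-> _ _] := fE u uX; have [-> _ _] := fE v vX; rewrite fuv.
- by move=> u /fE[].
- by have [_ _ fY] := fE u uX; rewrite (disjointFl dXY fY).
exists M => //; split=> //; rewrite covM setUS //.
by apply/subsetP=> v /imsetP[u /fE[_ _ fY] ->].
Qed.

Lemma subset_between X Y m : X \subset Y -> #|X| <= m <= #|Y| ->
  exists Z : {set 'I_n}, [/\ X \subset Z, Z \subset Y & #|Z| = m].
Proof.
move=> sXY /andP[]; elim: m => [|m IHm] leX leY.
  by exists X; split=> //; apply/eqP; rewrite -leqn0.
have [eqX|ltX] := leqP m.+1 #|X|.
  by exists X; split=> //; apply/eqP; rewrite eqn_leq leX.
have [Z [sXZ sZY cZ]] := IHm ltX (ltnW leY).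
have [x xY xZ] : exists2 x, x \in Y & x \notin Z.
  by apply/subsetPn; apply: contraL leY => /subset_leq_card; rewrite cZ -leqNgt.
exists (x |: Z); split; first exact: subset_trans sXZ (subsetU1 _ _).
  by rewrite subUset sub1set xY.
by rewrite cardsU1 xZ cZ.
Qed.

End Matchings.

(* a is the threshold below which a degree is small, Dl bounds the degrees, and b
   is an expansion parameter for sets smaller than s0. Path lengths 1, 2 and 4 are
   those needed to match the small vertices to distinct neighbours so that any other
   vertex sees at most one small vertex and at most one partner of a small vertex. *)
Record typical n (a b Dl s0 : nat) (E : {set vpair n}) : Prop := Typical {
  typ_deg1 : forall u, exists v, adj E u v;
  typ_maxdeg : forall u, #|nbr E u| <= Dl;
  typ_small : forall u s, path (adj E) u s -> uniq (u :: s) ->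
    size s \in [:: 1; 2; 4] -> ~~ ((#|nbr E u| < a) && (#|nbr E (last u s)| < a));
  typ_large : forall S T : {set 'I_n}, [disjoint S & T] -> s0 <= #|S| -> s0 <= #|T| ->
    exists u v, [/\ u \in S, v \in T & adj E u v];
  typ_sparse : forall S T : {set 'I_n}, [disjoint S & T] -> S != set0 -> #|S| < s0 ->
    #|T| <= #|S| -> exists2 v, v \in S & #|nbr E v :&: T| < b }.

Lemma subn_half m : m - m./2 = uphalf m.
Proof. by rewrite uphalf_half; have := odd_double_half m; lia. Qed.

Lemma leq_half_uphalf m : m./2 <= uphalf m.
Proof. by rewrite uphalf_half leq_addl. Qed.

(** * Matchings inside one typical graph *)

Section Typical.
Variables (n a b Dl s0 : nat) (E : {set vpair n}).
Hypothesis typE : typical a b Dl s0 E.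
Implicit Types (u v : 'I_n) (S T X Y U : {set 'I_n}).

Let D := [set u | #|nbr E u| < a].

Let nonadjD u v : u \in D -> v \in D -> ~~ adj E u v.
Proof.
rewrite !inE => uD vD; apply/negP=> uv.
have := typ_small typE (u := u) (s := [:: v]); rewrite /= uv uD vD !inE /=.
by rewrite (adj_neq uv) => /(_ isT isT isT).
Qed.

Let no_commonD u v w : u \in D -> v \in D -> adj E u w -> adj E w v -> u = v.
Proof.
rewrite !inE => uD vD uw wv; apply/eqP/negPn/negP => uv.
have := typ_small typE (u := u) (s := [:: w; v]); rewrite /= uw wv uD vD !inE /=.
by rewrite negb_or uv (adj_neq uw) (adj_neq wv) => /(_ isT isT isT).
Qed.

(** Vertices of small degree are pairwise non-adjacent, whereas two disjoint sets of size s0 are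
    joined by an edge. *)
Lemma card_small_vertices : 0 < s0 -> #|[set u | #|nbr E u| < a]| < 2 * s0.
Proof.
move=> s00; rewrite -/D ltnNge; apply/negP=> le.
have [|S [_ sSD cS]] := @subset_between _ set0 D s0 (sub0set _).
  by rewrite cards0 /=; apply: leq_trans le; lia.
have [|||u [v [uS]]] := typ_large typE (S := S) (T := D :\: S).
- by rewrite disjoints_subset; apply/subsetP=> x xS; rewrite !inE xS.
- by rewrite cS.
- by rewrite cardsD (setIidPr sSD) cS; rewrite leq_subRL; apply: leq_trans le; lia.
rewrite inE => /andP[_ vD]; apply/negP; apply: nonadjD => //; exact: (subsetP sSD).
Qed.

(** Each small vertex takes an arbitrary neighbour; no two share one, since that would be a path of
    length 2. The last clause bounds what an uncovered vertex loses: one small vertex and one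
    partner. *)
Lemma small_vertices_matching : exists2 M : {set vpair n}, M \subset E &
  [/\ matching M, #|M| = #|[set u | #|nbr E u| < a]|,
      forall u, u \notin cov M -> a <= #|nbr E u| &
      forall u, u \notin cov M -> #|nbr E u :&: cov M| <= 2].
Proof.
pose f u := odflt u [pick v | adj E u v].
have fE u : adj E u (f u).
  by rewrite /f; case: pickP => // noadj; have [v] := typ_deg1 typE u; rewrite noadj.
have [|||M sM [mM cM covM]] := @matching_of_fun _ E f D.
- move=> u v uD vD fuv; apply: no_commonD uD vD (fE u) _.
  by rewrite adj_sym fuv fE.
- by move=> u _; apply: fE.
- by move=> u uD; apply/negP=> /(nonadjD uD); rewrite fE.
exists M => //; rewrite cM -/D; split=> // u; rewrite covM !inE negb_or -leqNgt => /andP[uD ufD].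
  by [].
rewrite setIUr; apply: leq_trans (leq_card_setU _ _) _.
have le1 : #|nbr E u :&: D| <= 1.
  apply/card_le1_eqP=> v w; rewrite !in_setI !in_nbr => /andP[uv vD] /andP[uw wD].
  by apply: (@no_commonD w v u) => //; rewrite adj_sym.
have le2 : #|nbr E u :&: f @: D| <= 1.
  apply/card_le1_eqP=> v w; rewrite !in_setI !in_nbr.
  move=> /andP[uv /imsetP[x xD vE]] /andP[uw /imsetP[y yD wE]]; subst v w.
  have [->//|xy] := eqVneq x y.
  have xf z : z \in D -> (z == u) = false by move=> zD; apply: contraTF zD => /eqP->; rewrite inE -leqNgt.
  (* Two distinct partners adjacent to u would give the path x, [f x], u, [f y], y of length 4
     between small vertices. The rewriting that follows checks that its five vertices are
     distinct. *)
  have := typ_small typE (u := x) (s := [:: f x; u; f y; y]).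
  rewrite /= fE (adj_sym _ (f x)) uv uw (adj_sym _ (f y)) fE.
  move: (xD) (yD); rewrite !inE => -> -> /= /(_ isT).
  have fD z z' : z \in D -> z' \in D -> (z == f z') = false.
    by move=> zD z'D; apply: contraNF (nonadjD z'D zD) => /eqP->; rewrite fE.
  have fxfy : f x != f y.
    by apply: contra_neq xy => fxy; apply: no_commonD xD yD (fE x) _; rewrite adj_sym fxy fE.
  rewrite !negb_or xy fxfy (eq_sym (f x) u) (adj_neq uv) (adj_neq uw).
  rewrite (fD x x xD xD) (fD x y xD yD) (xf x xD) (eq_sym (f x) y) (fD y x yD xD).
  by rewrite (eq_sym u y) (xf y yD) (eq_sym (f y) y) (fD y y yD yD) => /(_ isT isT).
exact: leq_add le1 le2.
Qed.

(* X and Y are the reservoirs that make Hall's condition hold for small sets; the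
   remaining vertices of U only serve to balance the two sides. *)
Lemma balanced_matching X Y U : X \subset U -> Y \subset U -> [disjoint X & Y] ->
  #|Y| <= #|U|./2 -> #|X| <= uphalf #|U| ->
  (forall u, u \in U -> b <= #|nbr E u :&: X|) ->
  (forall u, u \in U -> b <= #|nbr E u :&: Y|) ->
  exists2 M : {set vpair n}, M \subset E &
    [/\ matching M, #|M| = #|U|./2 & cov M \subset U].
Proof.
move=> sXU sYU dXY leY leX degX degY.
have [||Y' [sYY' sY'U cY']] := @subset_between _ Y (U :\: X) #|U|./2.
- by rewrite subsetD sYU disjoint_sym.
- by rewrite leY cardsD (setIidPr sXU); move: leX; rewrite -subn_half; clear; lia.
have [sY'U' dY'X] : Y' \subset U /\ [disjoint Y' & X].
  by apply/andP; rewrite -subsetD.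
pose X' := U :\: Y'.
have sXX' : X \subset X' by rewrite subsetD sXU disjoint_sym.
have dY'X' : [disjoint Y' & X'].
  by rewrite disjoints_subset; apply/subsetP=> x xY; rewrite !inE xY.
have cX' : #|X'| = uphalf #|U|.
  by rewrite cardsD (setIidPr sY'U') cY' subn_half.
have sX'U : X' \subset U := subsetDl _ _.
have leYX : #|Y'| <= #|X'| by rewrite cX' cY' leq_half_uphalf.
(* Hall's theorem is applied from the smaller side Y'; if U has odd size, the vertex left over lies
   in X'. *)
have [|M sM [mM cM covM]] := @hall_matching _ E Y' X' dY'X'; last first.
- exists M => //; split=> //; first by rewrite cM.
  by apply: subset_trans covM _; rewrite subUset sY'U'.
move=> S sS; set N := [set v in X' | _]; rewrite leqNgt; apply/negP=> ltN.
have sNX' : N \subset X' by apply/subsetP=> x; rewrite inE => /andP[].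
have dSN : [disjoint S & N].
  exact: disjointWl sS (disjointWr sNX' dY'X').
have S0 : S != set0 by rewrite -card_gt0; apply: leq_ltn_trans ltN.
(* A small violating S contradicts sparsity of the pair (S, N): all neighbours in X of a vertex of S
   lie in N. *)
have [ltS|leS] := ltnP #|S| s0.
  have [v vS] := typ_sparse typE dSN S0 ltS (ltnW ltN).
  apply/negP; rewrite -leqNgt.
  have vU : v \in U by apply: (subsetP sY'U'); apply: (subsetP sS).
  apply: leq_trans (degX v vU) _; apply/subset_leq_card/subsetP=> x.
  rewrite !inE => /andP[vx xX]; rewrite vx /=.
  have := subsetP sXX' x xX; rewrite inE => -> /=.
  by apply/existsP; exists v; rewrite vS.
(* For large S the complementary pair is used. No edge joins S to T, so T has fewer than s0
   vertices. Also S' is no larger than T, and it contains all neighbours in Y of every vertex of T;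
   this contradicts sparsity again. *)
pose T := X' :\: N; pose S' := Y' :\: S.
have noadj u v : u \in S -> v \in T -> ~~ adj E u v.
  move=> uS; rewrite !inE => /andP[vN vX']; apply: contra vN => uv.
  by rewrite vX' /=; apply/existsP; exists u; rewrite uS.
have dTS : [disjoint T & S].
  rewrite disjoint_sym; apply: disjointWl sS (disjointWr _ dY'X'); exact: subsetDl.
have cT : #|T| = #|X'| - #|N| by rewrite cardsD (setIidPr sNX').
have cS' : #|S'| = #|Y'| - #|S| by rewrite cardsD (setIidPr sS).
have leSY := subset_leq_card sS.
have ltT : #|T| < s0.
  rewrite ltnNge; apply/negP=> leT.
  have [u [v [uS vT]]] := typ_large typE (S := S) (T := T) ltac:(by rewrite disjoint_sym) leS leT.
  by apply/negP; apply: noadj.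
have dTS' : [disjoint T & S'].
  by rewrite disjoint_sym; apply: disjointWl (subsetDl _ _) (disjointWr (subsetDl _ _) dY'X').
have T0 : T != set0.
  by rewrite -card_gt0 cT subn_gt0; apply: leq_trans ltN (leq_trans leSY leYX).
have [|v vT] := typ_sparse typE dTS' T0 ltT.
  by rewrite cT cS'; move: ltN leYX leSY; clear; lia.
apply/negP; rewrite -leqNgt.
have vU : v \in U by apply: (subsetP sX'U); move: vT; rewrite inE => /andP[].
apply: leq_trans (degY v vU) _; apply/subset_leq_card/subsetP=> x.
rewrite !in_setI !in_nbr => /andP[vx xY]; rewrite vx /= inE (subsetP sYY') // andbT.
by apply: contraL vx => xS; rewrite adj_sym; apply: noadj.
Qed.

End Typical.

(** The room left by the dominant colour, with c the number of edges used for small vertices, x1 and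
    x2 the sizes of X and Y, and m0 the largest m_i. Multiplied by 16q, the left side is at most 2n
    + (4n - 32q) + 2n, and the right side is at least 16h, hence at least 8n - 8. This fixes the
    constant 16. *)
Lemma size_arith q s0 n h c x1 x2 m0 : 0 < q -> 16 * q * s0 <= n -> c < 2 * s0 ->
  16 * q * x1 <= n -> 16 * q * x2 <= n -> n = odd n + h.*2 -> h <= q * m0 ->
  2 * s0 + 2 * c + (x1 + x2) <= m0.
Proof.
move=> q0 les0 cs le1 le2 nE leh.
have o1 : odd n <= 1 by case: (odd n).
have cq : 16 * q * c + 16 * q <= 2 * (16 * q * s0).
  by rewrite -mulnSr mulnCA leq_mul2l cs orbT.
rewrite -(@leq_pmul2l (16 * q)) ?muln_gt0 //.
have -> : 16 * q * (2 * s0 + 2 * c + (x1 + x2)) =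
  2 * (16 * q * s0) + 2 * (16 * q * c) + (16 * q * x1 + 16 * q * x2) by ring.
rewrite -(mulnA 16 q m0).
move: (16 * q * s0) (16 * q * c) (16 * q * x1) (16 * q * x2) (q * m0) les0 le1 le2 leh cq.
by move: nE o1 q0; clear; lia.
Qed.

(** * Prescribed colour counts from typical colour classes *)

Section Profile.
Variables (n q s0 : nat) (cl : 'I_q -> {set vpair n}).
Hypothesis disj_cl : forall i j, i != j -> [disjoint cl i & cl j].
Hypothesis large_cl : forall i (S T : {set 'I_n}), [disjoint S & T] ->
  s0 <= #|S| -> s0 <= #|T| -> exists u v, [/\ u \in S, v \in T & adj (cl i) u v].

(** While 2 s0 vertices are free, two disjoint sets of s0 free vertices are joined by an edge of any
    wanted colour. Since the classes are disjoint, this edge changes the count of its own colour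
    only. *)
Lemma greedy_matching N (m : 'I_q -> nat) (Z : {set 'I_n}) :
  \sum_i m i = N -> 2 * s0 + 2 * N <= #|Z| ->
  exists M : {set vpair n}, [/\ matching M, #|M| = N, cov M \subset Z,
    M \subset \bigcup_i cl i & forall i, #|cl i :&: M| = m i].
Proof.
elim: N m Z => [|N IHN] m Z sm leZ.
  exists set0; rewrite /cov big_set0 !sub0set cards0; split=> // [e|i].
    by rewrite inE.
  move/eqP: sm; rewrite sum_nat_eq0 => /forallP/(_ i)/eqP ->.
  by rewrite setI0 cards0.
have [i mi|m0] := pickP (fun i => 0 < m i); last first.
  move: sm; rewrite big1 // => i _; apply/eqP.
  by rewrite -leqn0 leqNgt m0.
have [|S [_ sSZ cS]] := @subset_between _ set0 Z s0 (sub0set _).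
  by rewrite cards0 /=; apply: leq_trans leZ; clear; lia.
have [|||u [v [uS vT /adjP[e ei ve]]]] := large_cl i (S := S) (T := Z :\: S).
- by rewrite disjoints_subset; apply/subsetP=> x xS; rewrite !inE xS.
- by rewrite cS.
- by rewrite cardsD (setIidPr sSZ) cS; move: leZ; clear; lia.
have eZ : val e \subset Z.
  by rewrite ve; apply/subsetP=> x /set2P[]->; [apply: (subsetP sSZ) | move: vT; rewrite inE => /andP[]].
have [||M [mM cM covM sM dM]] := IHN (fun j => m j - (j == i)) (Z :\: val e).
- have := sm; rewrite (bigD1 i) //= [in X in _ -> X](bigD1 i) //= eqxx.
  rewrite [X in _ -> _ + X = _](eq_bigr m) => [|j /negPf ->]; last by rewrite subn0.
  by move: mi; clear; lia.
- by rewrite cardsD (setIidPr eZ) (eqP (valP e)); move: leZ; clear; lia.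
have dis : [disjoint cov [set e] & cov M].
  rewrite cov1 disjoint_sym disjoints_subset; apply: subset_trans covM _.
  by apply/subsetP=> x; rewrite !inE => /andP[].
exists ([set e] :|: M); split.
- by apply: matchingU => //; apply: matching1.
- by rewrite card_matchingU // cards1 cM.
- by rewrite covU cov1 subUset eZ; apply: subset_trans covM (subsetDl _ _).
- by rewrite subUset sM sub1set andbT; apply/bigcupP; exists i.
- move=> j; have eM : e \notin M.
    have := card_matchingU dis; rewrite cardsU1 cards1 => /addIn.
    by case: (e \in M).
  have [ji|ji] := eqVneq j i.
    subst j; rewrite setIUr (setIidPr _) ?sub1set // cardsU1 dM eqxx inE (negPf eM) andbF.
    by move: mi; clear; lia.
  rewrite setIUr; have -> : cl j :&: [set e] = set0.
    by apply/setP=> x; rewrite !inE; apply/negP=> /andP[xj /eqP xe];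
       have := disjointFr (disj_cl ji) xj; rewrite xe ei.
  by rewrite set0U dM (negPf ji) subn0.
Qed.

(* The colour i0 used most takes care of the small vertices and of the last step.
   X j1 and X j2 are the two smallest label classes, so that enough vertices remain
   for picking the edges of all other colours greedily. *)
Lemma profile_matching (R : realFieldType) (k : nat) (a b Dl : 'I_q -> nat) (m : 'I_q -> nat) :
  0 < q -> 0 < s0 -> 16 * q * s0 <= n -> k = (16 * q).+1 ->
  (forall i, 0 < Dl i) ->
  (forall i, typical (a i) (b i) (Dl i) s0 (cl i)) ->
  (forall i, k%:R * 2 ^+ (b i).+2 * (1 - (2 * k)%:R^-1) ^+ a i * (4 * Dl i ^ 2)%:R <= 1 :> R)%R ->
  \sum_i m i = n./2 ->
  exists M : {set vpair n}, [/\ matching M, M \subset \bigcup_i cl i &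
    forall i, #|cl i :&: M| = m i].
Proof.
move=> q0 s00 les0 kE Dl0 typ num sm.
pose i0 := [arg max_(i > Ordinal q0) m i].
have maxi0 i : m i <= m i0 by rewrite /i0; case: arg_maxnP => // j _; apply.
have le_i0 : n./2 <= q * m i0.
  rewrite -sm; apply: (@leq_trans (\sum_(i < q) m i0)); first exact: leq_sum.
  by rewrite sum_nat_const card_ord.
clearbody i0.
have cD := card_small_vertices (typ i0) s00.
have [M0 sM0 [mM0 cM0 degM0 nbrM0]] := small_vertices_matching (typ i0).
rewrite -cM0 in cD.
have k0 : 0 < k by rewrite kE.
have [f fP] := split_labels k0 (Dl0 i0) (nbr_sym (cl i0)) (typ_maxdeg (typ i0)) (num i0).
pose W := ~: cov M0.
pose X j := [set u in W | f u == j].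
have dX i j : i != j -> [disjoint X i & X j].
  move=> ij; rewrite disjoints_subset; apply/subsetP=> u; rewrite !inE => /andP[-> /eqP->].
  exact: ij.
have sumX : \sum_j #|X j| <= n.
  rewrite -[n in _ <= n]card_ord -cardsT.
  apply: (@leq_trans #|W|); last exact/subset_leq_card/subsetT.
  by rewrite -[#|W|]sum1_card (partition_big f predT) //=; apply: leq_sum => j _;
     rewrite -sum1_card; apply/eq_leq/eq_bigl => u; rewrite inE.
(* The labelling gives b + 2 neighbours in each label class; at most two of them are covered by
   M0. *)
have degX u j : u \in W -> b i0 <= #|nbr (cl i0) u :&: X j|.
  move=> uW; have uM0 : u \notin cov M0 by rewrite inE in uW.
  have := fP u (degM0 u uM0) j; have := nbrM0 u uM0.
  have : #|[set v in nbr (cl i0) u | f v == j]| <=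
     #|nbr (cl i0) u :&: X j| + #|nbr (cl i0) u :&: cov M0|.
    apply: leq_trans (leq_card_setU _ _); apply/subset_leq_card/subsetP=> v.
    by rewrite !inE => /andP[-> ->] /=; rewrite andbT orNb.
  clear; lia.
(* The second smallest class is at most the average over the k - 1 = 16q classes other than the
   smallest, hence at most n/(16q). This is the reason for k = 16q + 1. *)
have [j1 [j2 [j12 cj1 cj2]]] : exists j1 j2, [/\ j1 != j2, 16 * q * #|X j1| <= n & 16 * q * #|X j2| <= n].
  pose j1 := [arg min_(j < Ordinal k0) #|X j|].
  have min1 j : #|X j1| <= #|X j| by rewrite /j1; case: arg_minnP => // i _; apply.
  have [j' j'1] : exists j', j' != j1.
    have : 0 < #|[set~ j1]| by rewrite cardsC1 card_ord kE; move: q0; clear; lia.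
    by case/card_gt0P=> j'; rewrite !inE; exists j'.
  pose j2 := [arg min_(j < j' | j != j1) #|X j|].
  have [j21 min2] : j2 != j1 /\ forall j, j != j1 -> #|X j2| <= #|X j|.
    by rewrite /j2; case: arg_minnP => // i i1 mini; split.
  have le2 : 16 * q * #|X j2| <= n.
    apply: leq_trans sumX; rewrite (bigD1 j1) //=.
    apply: leq_trans (leq_addl _ _).
    apply: (@leq_trans (\sum_(i < k | i != j1) #|X j2|)); last exact: leq_sum.
    by rewrite sum_nat_const leq_mul2r cardC1 card_ord kE leqnn orbT.
  exists j1, j2; split; rewrite ?(eq_sym j1) //.
  by apply: leq_trans le2; rewrite leq_mul2l min1 orbT.
pose Z := W :\: (X j1 :|: X j2).
pose m' i := if i == i0 then 0 else m i.
have sm' : m i0 + \sum_i m' i = n./2.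
  rewrite -sm [RHS](bigD1 i0) //= (bigD1 (P := predT) i0) //= /m' eqxx add0n.
  by congr (_ + _); apply: eq_bigr => i /negPf ->.
have cC0 := card_cov mM0.
have cW : #|W| = n - 2 * #|M0| by rewrite cardsCs setCK card_ord cC0.
have leM0n : 2 * #|M0| <= n.
  by rewrite -cC0 -[n in _ <= n]card_ord -cardsT; apply/subset_leq_card/subsetT.
have sXW j : X j \subset W by apply/subsetP=> u; rewrite inE => /andP[].
have n2 := odd_double_half n.
have cZ : n - 2 * #|M0| - (#|X j1| + #|X j2|) <= #|Z|.
  rewrite -cW cardsD; apply: leq_sub => //; apply: leq_trans (leq_card_setU _ _).
  by apply/subset_leq_card/subsetIr.
have [le1 le2] : 2 * s0 + 2 * \sum_i m' i <= n - 2 * #|M0| - (#|X j1| + #|X j2|)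
    /\ #|X j1| + #|X j2| + 2 * #|M0| <= m i0.
  have := size_arith q0 les0 cD cj1 cj2 (esym n2) le_i0.
  by move: sm' n2; clear; lia.
have [M' [mM' cM' covM' sM' dM']] := greedy_matching (erefl (\sum_i m' i)) (leq_trans le1 cZ).
pose U := W :\: cov M'.
have sM'W : cov M' \subset W by apply: subset_trans covM' (subsetDl _ _).
have cU : #|U| = n - 2 * #|M0| - 2 * \sum_i m' i.
  by rewrite cardsD (setIidPr sM'W) cW card_cov // cM'.
(* Half of U, rounded down, is then exactly the number of edges of colour i0 still missing; for odd
   n one vertex stays free. *)
have cU2 : #|U| = odd n + (m i0 - #|M0|).*2.
  rewrite cU; move: sm' n2 le2; clear; lia.
have cUh : #|U|./2 = m i0 - #|M0| by rewrite cU2 half_bit_double.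
have sXU j : j \in [:: j1; j2] -> X j \subset U.
  move=> jj; rewrite subsetD sXW /= disjoint_sym; apply: disjointWl covM' _.
  rewrite disjoints_subset; apply/subsetP=> u; rewrite !inE negb_or => /andP[/andP[n1 n2'] uW].
  by move: jj n1 n2'; rewrite !inE uW => /orP[]/eqP-> // /negPf->.
have [|||||||MH sMH [mMH cMH covMH]] := balanced_matching (typ i0) (X := X j1) (Y := X j2) (U := U).
- by apply: sXU; rewrite !inE eqxx.
- by apply: sXU; rewrite !inE eqxx orbT.
- exact: dX.
- by rewrite cUh; move: le2; clear; lia.
- by apply: leq_trans (leq_half_uphalf _); rewrite cUh; move: le2; clear; lia.
- by move=> u; rewrite inE => /andP[_]; apply: degX.
- by move=> u; rewrite inE => /andP[_]; apply: degX.
have d0' : [disjoint cov M0 & cov M'].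
  by rewrite disjoint_sym disjoints_subset.
have d0H : [disjoint cov M0 & cov MH].
  by rewrite disjoint_sym disjoints_subset; apply: subset_trans covMH (subsetDl _ _).
have d'H : [disjoint cov M0 :|: cov MH & cov M'].
  rewrite disjoints_subset subUset -!disjoints_subset d0'.
  by apply: disjointWl covMH _; rewrite disjoints_subset; apply/subsetP=> x; rewrite !inE => /andP[].
have sMi0 : M0 :|: MH \subset cl i0 by rewrite subUset sM0.
exists ((M0 :|: MH) :|: M'); split.
- by apply: matchingU => //; [apply: matchingU | rewrite covU].
- by rewrite subUset sM' andbT; apply: subset_trans sMi0 (bigcup_sup i0 _).
move=> i; rewrite setIUr.
have := dM' i; rewrite /m'; have [->|ii0 cM'i] := eqVneq i i0.
  move/eqP; rewrite cards_eq0 => /eqP->; rewrite setU0 (setIidPr sMi0).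
  by rewrite card_matchingU // cMH cUh; move: le2; clear; lia.
suff -> : cl i :&: (M0 :|: MH) = set0 by rewrite set0U.
apply/eqP; rewrite setI_eq0; exact: disjointWr sMi0 (disj_cl ii0).
Qed.

End Profile.

(** * Random graph estimates *)

Section Cuts.
Variable n : nat.
Implicit Types (E : {set vpair n}) (u v : 'I_n) (S T : {set 'I_n}).

(** Degrees, absence of edges and sparsity all become statements on [#|E :&: cut S T|], the number
    of edges in a fixed set of pairs, to which one moment bound applies. *)
Definition cut S T : {set vpair n} :=
  [set e | [exists u in S, exists v in T, val e == [set u; v]]].

Lemma cutP S T (e : vpair n) :
  reflect (exists u v, [/\ u \in S, v \in T & val e = [set u; v]]) (e \in cut S T).
Proof.
rewrite inE; apply: (iffP existsP) => [[u /andP[uS /existsP[v /andP[vT /eqP ve]]]]|].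
  by exists u, v.
by case=> u [v [uS vT ve]]; exists u; rewrite uS; apply/existsP; exists v; rewrite vT ve eqxx.
Qed.

Lemma card_cutI E S T : [disjoint S & T] ->
  #|E :&: cut S T| = \sum_(u in S) #|nbr E u :&: T|.
Proof.
move=> dST; pose P := [set w : 'I_n * 'I_n | [&& w.1 \in S, w.2 \in T & adj E w.1 w.2]].
have injP : {in P &, injective (fun w : 'I_n * 'I_n => [set w.1; w.2])}.
  move=> [u v] [u' v']; rewrite !inE /= => /and3P[uS vT _] /and3P[u'S v'T _] /setP eq.
  have uv' : (u == v') = false by apply: contraTF v'T => /eqP<-; rewrite (disjointFr dST).
  have vu' : (v == u') = false by apply: contraTF vT => /eqP->; rewrite (disjointFr dST).
  have := eq u; have := eq v; rewrite !inE !eqxx uv' vu' orbT orbF /=.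
  by move=> /esym/eqP-> /esym/eqP->.
have -> : #|E :&: cut S T| = #|P|.
  rewrite -(card_imset _ val_inj) -(card_in_imset injP); apply: eq_card => X.
  apply/imsetP/imsetP => [[e]|[[u v]]].
    rewrite inE => /andP[eE /cutP[u [v [uS vT ve]]]] ->; exists (u, v) => //.
    by rewrite inE /= uS vT; apply/adjP; exists e.
  rewrite inE /= => /and3P[uS vT /adjP[e eE ve]] ->; exists e => //.
  by rewrite inE eE; apply/cutP; exists u, v.
rewrite -sum1_card (eq_bigl (fun w : 'I_n * 'I_n => (w.1 \in S) && (w.2 \in nbr E w.1 :&: T))).
  rewrite -(pair_big_dep (fun u => u \in S) (fun u v => v \in nbr E u :&: T) (fun _ _ => 1)) /=.
  by apply: eq_bigr => u _; rewrite sum1_card.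
by move=> w; rewrite !inE; case: (_ \in S) => //=; rewrite andbC.
Qed.

Lemma card_cut S T : [disjoint S & T] -> #|cut S T| = #|S| * #|T|.
Proof.
move=> dST; rewrite -[cut S T]setTI card_cutI // -sum_nat_const; apply: eq_bigr => u uS.
congr #|pred_of_set _|; apply/setIidPr/subsetP => v vT; rewrite in_nbr; apply/adjP.
have uv : #|[set u; v]| == 2.
  by rewrite cards2 (_ : u != v) //; apply: contraTneq vT => <-; rewrite (disjointFr dST).
by exists (Sub [set u; v] uv); rewrite ?inE ?SubK.
Qed.

(** Each step enters as a set of pairs, so no proof that its ends differ is needed; a degenerate
    step contributes nothing. *)
Fixpoint path_edges u (s : seq 'I_n) : {set vpair n} :=
  if s is v :: s' then [set e : vpair n | val e == [set u; v]] :|: path_edges v s' else set0.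

Lemma path_edges_sub E u s : path (adj E) u s -> path_edges u s \subset E.
Proof.
elim: s u => [|v s IHs] u /=; first by rewrite sub0set.
case/andP=> /adjP[e eE ve] /IHs sE; rewrite subUset sE andbT.
by apply/subsetP=> f; rewrite inE -ve => /eqP/val_inj->.
Qed.

Lemma path_edges_vertices u s e : e \in path_edges u s -> {subset val e <= u :: s}.
Proof.
elim: s u => [|v s IHs] u /=; first by rewrite inE.
rewrite !inE => /orP[/eqP-> x|/IHs sub x /sub]; rewrite !inE.
  by case/orP=> ->; rewrite ?orbT.
by move=> ->; rewrite orbT.
Qed.

Lemma card_path_edges u s : uniq (u :: s) -> #|path_edges u s| = size s.
Proof.
elim: s u => [|v s IHs] u; first by rewrite cards0.
move=> us; have [uvs vs] : u \notin v :: s /\ uniq (v :: s) by move: us => /andP[].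
rewrite /path_edges -/path_edges.
have uv : #|[set u; v]| == 2 by rewrite cards2; move: uvs; rewrite inE; case: eqVneq.
have -> : [set e : vpair n | val e == [set u; v]] = [set (Sub [set u; v] uv : vpair n)].
  by apply/setP=> e; rewrite !inE; apply/eqP/eqP=> [ve|->]; [apply: val_inj|]; rewrite SubK.
rewrite cardsU1 (IHs v) //=; case: (boolP (_ \in _)) => // /path_edges_vertices.
by move/(_ u); rewrite SubK !inE eqxx => /(_ isT); rewrite -in_cons (negPf uvs).
Qed.

End Cuts.

(** * Independent edges and exponential moments *)

Section GraphProbability.
Local Open Scope ring_scope.
Variables (R : realType) (n : nat) (p : R).
Hypothesis p01 : 0 <= p <= 1.
Implicit Types (E L A : {set vpair n}).

Definition gprob (Q : pred {set vpair n}) : R := \sum_(E | Q E) gnp p E.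

Lemma gnp_ge0 E : 0 <= gnp p E.
Proof.
case/andP: p01 => p0 p1; apply: prodr_ge0 => e _.
by case: ifP => // _; rewrite subr_ge0.
Qed.

(** By independence the expectation is a product over the possible edges. The choice x = 0, with 0^0
    = 1, gives the event that E avoids A; x > 1 serves upper tails and 0 < x < 1 lower tails. *)
Lemma gnp_expectation L A (x : R) : [disjoint L & A] ->
  \sum_(E : {set vpair n}) gnp p E * ((L \subset E)%:R * x ^+ #|E :&: A|) =
  p ^+ #|L| * (1 - p + p * x) ^+ #|A|.
Proof.
move=> dLA.
transitivity (\sum_(E : {set vpair n}) \prod_e (if e \in E then p * (if e \in A then x else 1)
   else (1 - p) * (e \notin L)%:R)).
  apply: eq_bigr => E _.
  have -> : (L \subset E)%:R = \prod_(e : vpair n) (if e \in E then 1 else (e \notin L)%:R) :> R.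
    have [sLE|/subsetPn[e eL eE]] := boolP (L \subset E).
      rewrite big1 // => e _; case: ifP => // eE.
      by case: (boolP (e \in L)) => // /(subsetP sLE); rewrite eE.
    by rewrite (bigD1 e) //= (negPf eE) eL mul0r.
  have -> : x ^+ #|E :&: A| = \prod_(e : vpair n) (if e \in E then if e \in A then x else 1 else 1).
    rewrite -prodr_const big_mkcond; apply: eq_bigr => e _; rewrite inE.
    by case: (e \in E).
  rewrite /gnp -!big_split /=; apply: eq_bigr => e _.
  by case: (e \in E); rewrite ?mul1r ?mulr1.
transitivity (\prod_(e : vpair n) (p * (if e \in A then x else 1) + (1 - p) * (e \notin L)%:R)).
  by rewrite bigA_distr; apply: eq_big => // E; rewrite ?inE.
transitivity (\prod_(e : vpair n) ((if e \in L then p else 1) * (if e \in A then 1 - p + p * x else 1))).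
  apply: eq_bigr => e _; case: (boolP (e \in L)) => [eL|_] /=.
    by rewrite (disjointFr dLA eL) mulr0 addr0.
  by case: (e \in A); ring.
by rewrite big_split /= -!big_mkcond /= !prodr_const.
Qed.

(* A union bound combined with an exponential moment bound for each #|E :&: A i|. *)
Lemma gprob_union_le (I : finType) (P : pred I) (Q : pred {set vpair n})
    (w : I -> R) (L A : I -> {set vpair n}) (x : R) :
  0 <= x -> (forall i, P i -> [disjoint L i & A i]) -> (forall i, 0 <= w i) ->
  (forall E, Q E -> exists i, [/\ P i, L i \subset E & 1 <= w i * x ^+ #|E :&: A i|]) ->
  gprob Q <= \sum_(i | P i) w i * (p ^+ #|L i| * (1 - p + p * x) ^+ #|A i|).
Proof.
move=> x0 dLA w0 hQ.
under eq_bigr => i Pi do rewrite -(gnp_expectation x (dLA i Pi)) mulr_sumr.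
rewrite exchange_big /= /gprob big_mkcond /=; apply: ler_sum => E _.
have t0 i : 0 <= w i * (gnp p E * ((L i \subset E)%:R * x ^+ #|E :&: A i|)).
  by rewrite !mulr_ge0 ?w0 ?gnp_ge0 ?exprn_ge0.
case: ifP => [/hQ[i [Pi LE le1]]|_]; last by apply: sumr_ge0.
rewrite (bigD1 i) //= LE mul1r; apply: ler_wpDr; first by apply: sumr_ge0.
by rewrite mulrCA ler_peMr ?gnp_ge0.
Qed.

End GraphProbability.

Definition small_path n a l (E : {set vpair n}) := [exists w : 'I_n * l.-tuple 'I_n,
  [&& path (adj E) w.1 w.2, uniq (w.1 :: w.2), #|nbr E w.1| < a &
      #|nbr E (last w.1 w.2)| < a]].

(** * Failure probability of each typical property *)

Section Estimates.
Local Open Scope ring_scope.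
Variables (R : realType) (n : nat) (p d omega : R).
Hypothesis p01 : 0 <= p <= 1.
Hypothesis dE : d = p * n%:R.
Hypothesis omega_ge0 : 0 <= omega.
Hypothesis n_le : n%:R <= expR (d - omega).

Lemma expR1_le4 : expR 1 <= 4 :> R.
Proof.
have h : 2^-1 <= expR (- 2^-1) :> R by apply: le_trans (expR_ge1Dx _); lra.
have e2 : expR (2^-1) <= 2 :> R by rewrite -[leLHS]invrK -expRN invf_ple ?posrE ?expR_gt0.
have -> : 1 = 2^-1 + 2^-1 :> R by lra.
by rewrite expRD; apply: le_trans (ler_pM _ _ e2 e2) _; rewrite ?expR_ge0 //; lra.
Qed.

Lemma expRN2_le : expR (- 2) <= 4^-1 :> R.
Proof.
have h : 2 <= expR 1 :> R by apply: le_trans (expR_ge1Dx _); lra.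
rewrite expRN lef_pV2 ?posrE ?expR_gt0 //.
have -> : 2 = 1 + 1 :> R by lra.
by rewrite expRD; apply: le_trans (ler_pM _ _ h h); lra.
Qed.

Let p0 : 0 <= p. Proof. by case/andP: p01. Qed.

Let bin_exp_le (x : R) m : 0 <= x -> (1 - p + p * x) ^+ m <= expR (m%:R * (p * (x - 1))).
Proof.
move=> x0; case/andP: p01 => _ p1.
rewrite expRM_natl; apply: lerXn2r; rewrite ?nnegrE ?expR_ge0 //.
  by rewrite addr_ge0 ?subr_ge0 // mulr_ge0.
by apply: le_trans (expR_ge1Dx _); rewrite mulrBr mulr1; lra.
Qed.

Let star_disj (u : 'I_n) : [disjoint [set u] & [set~ u]].
Proof. by rewrite disjoints_subset setCK. Qed.

Let star_card (u : 'I_n) : #|cut [set u] [set~ u]| = n.-1.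
Proof.
by rewrite card_cut // cards1 mul1n cardsC1 card_ord.
Qed.

Let star_deg E (u : 'I_n) : #|E :&: cut [set u] [set~ u]| = #|nbr E u|.
Proof.
rewrite card_cutI // big_set1; apply: eq_card => v; rewrite !inE; case: (boolP (adj E u v)) => // /adj_neq.
by rewrite eq_sym.
Qed.

Let n1p (u : 'I_n) : d - p <= n.-1%:R * p.
Proof.
have n0 : (0 < n)%N := leq_ltn_trans (leq0n u) (ltn_ord u).
by rewrite dE -{1}(prednK n0) -natr1; lra.
Qed.

Lemma gprob_isolated :
  gprob p [pred E : {set vpair n} | [exists u, nbr E u == set0]] <= expR (1 - omega).
Proof.
case/andP: p01 => _ p1.
apply: le_trans (gprob_union_le p01 (I := 'I_n) (P := predT) (w := fun=> 1) (L := fun=> set0)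
   (A := fun u => cut [set u] [set~ u]) (lexx 0) _ _ _) _ => //.
- by move=> u _; rewrite disjoints_subset sub0set.
- move=> E /existsP[u /eqP uE]; exists u; split=> //; first exact: sub0set.
  by rewrite star_deg uE cards0 expr0 mulr1.
apply: le_trans (_ : \sum_(u < n) expR (p - d) <= _); last first.
  rewrite sumr_const card_ord -[_ *+ n]mulr_natl.
  apply: le_trans (ler_wpM2r (expR_ge0 _) n_le) _.
  by rewrite -expRD ler_expR; lra.
apply: ler_sum => u _; rewrite star_card cards0 expr0 !mul1r.
apply: le_trans (bin_exp_le _ (lexx 0)) _; rewrite ler_expR sub0r mulrN1 mulrN.
by have := n1p u; lra.
Qed.

(** Exponential moment with x = e: as e is at most 4, the moment is at most exp(3d). Against the
    weight exp(-5d) this leaves exp(-2d) for the sum over n vertices. *)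
Lemma gprob_maxdeg Dl : (forall m : nat, (Dl < m)%N -> 5 * d <= m%:R) ->
  gprob p [pred E : {set vpair n} | [exists u, (Dl < #|nbr E u|)%N]] <= expR (- omega).
Proof.
move=> hDl.
have d0 : 0 <= d by rewrite dE mulr_ge0.
apply: le_trans (gprob_union_le p01 (I := 'I_n) (P := predT) (w := fun=> expR (- (5 * d)))
   (L := fun=> set0) (A := fun u => cut [set u] [set~ u]) (expR_ge0 1) _ _ _) _ => //.
- by move=> u _; rewrite disjoints_subset sub0set.
- move=> E /existsP[u uE]; exists u; split=> //; first exact: sub0set.
  rewrite star_deg -expRM_natr mul1r -expRD -[leLHS]expR0 ler_expR.
  by have := hDl _ uE; lra.
apply: le_trans (_ : \sum_(u < n) expR (- (2 * d)) <= _); last first.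
  rewrite sumr_const card_ord -[_ *+ n]mulr_natl.
  apply: le_trans (ler_wpM2r (expR_ge0 _) n_le) _.
  by rewrite -expRD ler_expR; lra.
apply: ler_sum => u _; rewrite star_card cards0 expr0 !mul1r.
apply: le_trans (ler_wpM2l (expR_ge0 _) (bin_exp_le _ (expR_ge0 1))) _.
rewrite -expRD ler_expR.
have : n.-1%:R * (p * (expR 1 - 1)) <= 3 * d; last by lra.
have e1 : 0 <= expR 1 - 1 :> R by have := expR_ge1Dx (1 : R); lra.
have e3 : expR 1 - 1 <= 3 :> R by have := expR1_le4; lra.
have np : n.-1%:R * p <= d by rewrite dE mulrC ler_wpM2l // ler_nat leq_pred.
by rewrite mulrA mulrC; apply: ler_pM => //; rewrite mulr_ge0.
Qed.

(** Only edges from the two ends to vertices off the path are counted, so they are independent of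
    the path edges. At most d/8 of them occur; with x = exp(-2) the weight exp(d/4) times the moment
    is at most exp(8 - 5d/4). There are at most n^(l+1) paths, each present with probability p^l,
    which contributes n d^l, and n costs exp(d - omega). *)
Lemma gprob_small_path a l : (0 < l <= 4)%N -> (forall m : nat, (m < a)%N -> m%:R <= d / 16) ->
  gprob p [pred E : {set vpair n} | small_path a l E] <= d ^+ l * expR (8 - d / 4).
Proof.
move=> /andP[l0 l4] ha; case/andP: p01 => _ p1.
have d0 : 0 <= d by rewrite dE mulr_ge0.
pose A (w : 'I_n * l.-tuple 'I_n) := cut [set w.1; last w.1 w.2] (~: [set x in w.1 :: w.2]).
have dA (w : 'I_n * l.-tuple 'I_n) : [disjoint [set w.1; last w.1 w.2] & ~: [set x in w.1 :: w.2]].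
  rewrite disjoints_subset setCK; apply/subsetP=> x /set2P[]->; rewrite inE.
    exact: mem_head.
  exact: mem_last.
have last_neq (w : 'I_n * l.-tuple 'I_n) : uniq (w.1 :: w.2) -> w.1 != last w.1 w.2.
  case: w => u [[|v s] /= /eqP sz] /=; first by rewrite -sz in l0.
  by case/andP=> us _; apply: contraNneq us => ->; rewrite mem_last.
apply: le_trans (gprob_union_le p01 (I := ('I_n * l.-tuple 'I_n)%type)
   (P := fun w => uniq (w.1 :: w.2)) (w := fun=> expR (d / 4))
   (L := fun w => path_edges w.1 w.2) (A := A) (expR_ge0 (-2)) _ _ _) _ => //.
- move=> w _; rewrite disjoints_subset; apply/subsetP=> e /path_edges_vertices sub.
  rewrite inE; apply/cutP=> -[x [y [_ yC ve]]]; move: yC; rewrite !inE.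
  by have := sub y; rewrite ve !inE eqxx orbT => ->.
- move=> E /existsP[w /and4P[pw uw a1 a2]]; exists w; split=> //.
    exact: path_edges_sub.
  rewrite -expRM_natr -expRD -[leLHS]expR0 ler_expR card_cutI //.
  have le : (\sum_(u in [set w.1; last w.1 w.2]) #|nbr E u :&: ~: [set x in w.1 :: w.2]|)%:R
      <= d / 16 + d / 16.
    rewrite natr_sum big_setU1 ?inE ?last_neq //= big_set1.
    apply: lerD; apply: ha; apply: leq_ltn_trans (subset_leq_card (subsetIl _ _)) _; done.
  by move: le; lra.
apply: le_trans (_ : \sum_(w : 'I_n * l.-tuple 'I_n) p ^+ l * (expR (8 - d / 4 - d)) <= _); last first.
  rewrite sumr_const card_prod card_tuple card_ord -[leLHS]mulr_natl natrM natrX.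
  have -> : n%:R * n%:R ^+ l * (p ^+ l * expR (8 - d / 4 - d)) =
      d ^+ l * (n%:R * expR (8 - d / 4 - d)) by rewrite dE exprMn; ring.
  rewrite ler_wpM2l ?exprn_ge0 //; apply: le_trans (ler_wpM2r (expR_ge0 _) n_le) _.
  rewrite -expRD ler_expR; have := omega_ge0; lra.
rewrite [leRHS](bigID (fun w : 'I_n * l.-tuple 'I_n => uniq (w.1 :: w.2))) /=.
apply: ler_wpDr.
  by apply: sumr_ge0 => w _; rewrite mulr_ge0 ?exprn_ge0 ?expR_ge0.
apply: ler_sum => w uw0; have {uw0} uw : uniq (w.1 :: w.2) by [].
rewrite card_path_edges // size_tuple.
rewrite card_cut // cards2 last_neq //.
have -> : #|~: [set x in w.1 :: w.2]| = (n - l.+1)%N.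
  by rewrite cardsCs setCK card_ord cardsE (card_uniqP uw) /= size_tuple.
rewrite mulrCA ler_wpM2l ?exprn_ge0 //.
apply: le_trans (ler_wpM2l (expR_ge0 _) (bin_exp_le _ (expR_ge0 _))) _.
rewrite -expRD ler_expR natrM.
set m := (n - l.+1)%:R.
have lm : d - 5 * p <= m * p.
  rewrite dE mulrC -mulrBl ler_wpM2r // lerBlDr -natrD ler_nat.
  by move: l4; clear; lia.
have mp0 : 0 <= m * p by rewrite mulr_ge0.
have e34 : expR (-2) - 1 <= - (3 / 4) :> R by have := expRN2_le; lra.
have mpe := ler_wpM2l mp0 e34.
rewrite -(mulrA 2) [m * (p * _)]mulrA.
by lra.
Qed.

Lemma subset_weight_sum (y : R) : \sum_(S : {set 'I_n}) y ^+ #|S| = (1 + y) ^+ n.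
Proof.
transitivity (\prod_(i : 'I_n) (y + 1)); last first.
  by rewrite prodr_const card_ord addrC.
rewrite bigA_distr.
apply: eq_big => [S|S _]; first by rewrite ?inE.
by rewrite -big_mkcond /= prodr_const.
Qed.

Lemma gprob_large s0 (delta : R) : 0 < delta -> delta * n%:R <= s0%:R ->
  2 <= delta ^+ 2 * d -> (0 < n)%N ->
  gprob p [pred E : {set vpair n} | [exists w : {set 'I_n} * {set 'I_n},
     [&& [disjoint w.1 & w.2], (s0 <= #|w.1|)%N, (s0 <= #|w.2|)%N & E :&: cut w.1 w.2 == set0]]]
  <= expR (2 - delta ^+ 2 * d).
Proof.
move=> delta0 hs0 hd n0.
apply: le_trans (gprob_union_le p01 (I := ({set 'I_n} * {set 'I_n})%type)
   (P := fun w => [&& [disjoint w.1 & w.2], (s0 <= #|w.1|)%N & (s0 <= #|w.2|)%N]) (w := fun=> 1)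
   (L := fun=> set0) (A := fun w => cut w.1 w.2) (lexx 0) _ _ _) _ => //.
- by move=> w _; rewrite disjoints_subset sub0set.
- move=> E /existsP[w /and4P[w1 w2 w3 /eqP w4]]; exists w; rewrite w1 w2 w3; split=> //.
    exact: sub0set.
  by rewrite w4 cards0 expr0 mulr1.
have ds : delta ^+ 2 * d * n%:R <= s0%:R * s0%:R * p.
  have -> : delta ^+ 2 * d * n%:R = (delta * n%:R) * (delta * n%:R) * p by rewrite dE; ring.
  by rewrite ler_wpM2r //; apply: ler_pM => //; rewrite mulr_ge0 // ltW.
apply: le_trans (_ : \sum_(w : {set 'I_n} * {set 'I_n}) expR (- (delta ^+ 2 * d * n%:R)) <= _); last first.
  rewrite sumr_const card_prod -!cardsT -powersetT !card_powerset cardsT card_ord.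
  rewrite -[leLHS]mulr_natl natrM natrX.
  have h : 2 <= expR 1 :> R by apply: le_trans (expR_ge1Dx _); lra.
  have hn : 2 ^+ n <= expR n%:R :> R.
    by rewrite -[n%:R]mulr1 expRM_natl; apply: lerXn2r; rewrite ?nnegrE ?expR_ge0.
  apply: le_trans (_ : expR n%:R * expR n%:R * expR (- (delta ^+ 2 * d * n%:R)) <= _).
    by rewrite ler_wpM2r ?expR_ge0 //; apply: ler_pM.
  rewrite -!expRD ler_expR.
  have n1 : 1 <= n%:R :> R by rewrite ler1n.
  (* The exponent so far is n times 2 - delta^2 d. That factor is nonpositive and n is at least 1,
     so a single copy suffices. *)
  have : 0 <= (delta ^+ 2 * d - 2) * (n%:R - 1) by rewrite mulr_ge0 ?subr_ge0.
  by lra.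
rewrite [leLHS]big_mkcond /=; apply: ler_sum => w _.
case: ifP => [/and3P[w1 w2 w3]|_]; last exact: expR_ge0.
rewrite cards0 expr0 !mul1r; apply: le_trans (bin_exp_le _ (lexx 0)) _.
rewrite ler_expR card_cut // natrM sub0r mulrN1 mulrN lerN2; apply: le_trans ds _.
by rewrite ler_wpM2r //; apply: ler_pM; rewrite ?ler_nat.
Qed.

(* With x = 1 / delta = exp (6 / c), the weight x ^ (b |S|) >= exp (6 d |S|) beats the
   moment bound exp (d |S|) and the at most n ^ (2 |S|) choices of S and T. *)
Lemma gprob_sparse s0 b (c delta : R) : 0 < c -> delta = expR (- (6 / c)) ->
  (forall m : nat, (m < s0)%N -> m%:R <= delta * n%:R) -> c * d <= b%:R ->
  gprob p [pred E : {set vpair n} | [exists w : {set 'I_n} * {set 'I_n},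
     [&& [disjoint w.1 & w.2], w.1 != set0, (#|w.1| < s0)%N, (#|w.2| <= #|w.1|)%N &
         (b * #|w.1| <= #|E :&: cut w.1 w.2|)%N]]]
  <= (expR (expR (- d)) - 1) * expR (expR (- d)).
Proof.
move=> c0 deltaE hs0 hb.
have d0 : 0 <= d by rewrite dE mulr_ge0.
pose y := expR (- (2 * d)).
apply: le_trans (gprob_union_le p01 (I := ({set 'I_n} * {set 'I_n})%type)
   (P := fun w => [&& [disjoint w.1 & w.2], w.1 != set0, (#|w.1| < s0)%N & (#|w.2| <= #|w.1|)%N])
   (w := fun w => expR (- (6 * d * #|w.1|%:R)))
   (L := fun=> set0) (A := fun w => cut w.1 w.2) (expR_ge0 (6 / c)) _ _ _) _ => //.
- by move=> w _; rewrite disjoints_subset sub0set.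
- move=> E /existsP[w /and5P[w1 w2 w3 w4 w5]]; exists w; rewrite w1 w2 w3 w4; split=> //.
    exact: sub0set.
  rewrite -expRM_natr -expRD -[leLHS]expR0 ler_expR.
  have : c * d * #|w.1|%:R <= #|E :&: cut w.1 w.2|%:R.
    by apply: le_trans (ler_wpM2r _ hb) _ => //; rewrite -natrM ler_nat.
  have c6 : 0 <= 6 / c by rewrite divr_ge0 // ltW.
  move=> /(ler_wpM2l c6).
  have -> : 6 / c * (c * d * #|w.1|%:R) = 6 * d * #|w.1|%:R by field; rewrite gt_eqF.
  by lra.
(* After the moment bound an exponent of -5 d |S| remains, which is below -2d(|S| + |T|) because |T|
   is at most |S|. With T now unconstrained the sum factors, and S nonempty gives the [- 1] that
   makes the bound tend to 0. *)
apply: le_trans (_ : \sum_(w : {set 'I_n} * {set 'I_n} | w.1 != set0) y ^+ #|w.1| * y ^+ #|w.2| <= _).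
  rewrite [leLHS]big_mkcond [leRHS]big_mkcond /=; apply: ler_sum => w _.
  case: ifP => [/and4P[w1 -> w3 w4]|_]; last by case: ifP => // _; rewrite mulr_ge0 ?exprn_ge0 ?expR_ge0.
  rewrite cards0 expr0 mul1r.
  apply: le_trans (ler_wpM2l (expR_ge0 _) (bin_exp_le _ (expR_ge0 _))) _.
  rewrite /y -!expRM_natr -!expRD ler_expR card_cut // natrM.
  set s := #|w.1|%:R; set t := #|w.2|%:R.
  have ts : t <= s by rewrite ler_nat.
  (* The size bound delta n on T cancels the large base exp(6/c) = 1/delta. *)
  have dx : t * (p * expR (6 / c)) <= d.
    rewrite dE mulrA [t * p]mulrC -mulrA ler_wpM2l //.
    have := le_trans ts (hs0 _ w3); rewrite deltaE expRN => /(ler_wpM2r (expR_ge0 (6 / c))).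
    by rewrite mulrAC mulVf ?mul1r // gt_eqF // expR_gt0.
  have s00 : 0 <= s by [].
  have t00 : 0 <= t by [].
  have : s * t * (p * (expR (6 / c) - 1)) <= s * d.
    rewrite -mulrA ler_wpM2l //; apply: le_trans dx.
    by rewrite !ler_wpM2l // lerBlDr lerDl.
  have := ler_wpM2l d0 ts.
  have := mulr_ge0 d0 s00.
  by lra.
have yn : (1 + y) ^+ n <= expR (expR (- d)).
  apply: le_trans (_ : expR (n%:R * y) <= _).
    rewrite expRM_natl; apply: lerXn2r; rewrite ?nnegrE ?expR_ge0 ?expR_ge1Dx //.
    by rewrite addr_ge0 ?expR_ge0.
  rewrite ler_expR; apply: le_trans (ler_wpM2r (expR_ge0 _) n_le) _.
  by rewrite -expRD ler_expR; have := omega_ge0; lra.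
have -> : \sum_(w : {set 'I_n} * {set 'I_n} | w.1 != set0) y ^+ #|w.1| * y ^+ #|w.2| =
    \sum_(S : {set 'I_n} | S != set0) \sum_(T : {set 'I_n}) y ^+ #|S| * y ^+ #|T|.
  by rewrite pair_big; apply: eq_bigl => w; rewrite andbT.
under eq_bigr => S _ do rewrite -mulr_sumr subset_weight_sum.
rewrite -mulr_suml.
have -> : \sum_(S : {set 'I_n} | S != set0) y ^+ #|S| = (1 + y) ^+ n - 1.
  by rewrite -subset_weight_sum [X in X - 1](bigD1 set0) //= cards0 expr0 addrC addrK.
have y1 : 1 <= 1 + y by rewrite lerDl expR_ge0.
apply: ler_pM => //; rewrite ?subr_ge0 ?exprn_ege1 ?exprn_ge0 ?lerB //.
exact: le_trans y1.
Qed.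

End Estimates.

(** * One bound for the failure of typicality *)

Section TypicalProbability.
Local Open Scope ring_scope.
Variable R : realType.

(** Raise y <= exp(y), where y = c x/(m+1), to the power m + 1. This brings the exponential error
    terms that carry powers of d into the form K/d. *)
Lemma expR_poly_bound (m : nat) (c : R) : 0 < c ->
  exists2 K : R, 0 <= K & forall x, 0 < x -> x ^+ m * expR (- (c * x)) <= K / x.
Proof.
move=> c0; have m0 : 0 < m.+1%:R :> R by rewrite ltr0n.
exists ((m.+1%:R / c) ^+ m.+1) => [|x x0]; first by rewrite exprn_ge0 // divr_ge0 // ltW.
rewrite ler_pdivlMr // mulrAC -exprSr expRN ler_pdivrMr ?expR_gt0 //.
set y := c * x / m.+1%:R.
have yE : c * x = m.+1%:R * y by rewrite /y; field; rewrite gt_eqF.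
have xE : x = m.+1%:R / c * y by rewrite /y; field; rewrite !gt_eqF.
have mc0 : 0 < m.+1%:R / c by rewrite divr_gt0.
rewrite yE expRM_natl -exprMn; apply: lerXn2r; rewrite ?nnegrE; [exact: ltW|by rewrite ltW // mulr_gt0 ?expR_gt0|].
rewrite [leLHS]xE ler_pM2l //; apply: le_trans (expR_ge1Dx _).
by rewrite lerDr.
Qed.

Lemma gprobU n (p : R) (Q Q1 Q2 : pred {set vpair n}) : 0 <= p <= 1 ->
  (forall E, Q E -> Q1 E || Q2 E) -> gprob p Q <= gprob p Q1 + gprob p Q2.
Proof.
move=> p01 h; rewrite /gprob [leLHS]big_mkcond [X in _ <= X + _]big_mkcond [X in _ <= _ + X]big_mkcond.
rewrite -big_split /=; apply: ler_sum => E _.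
have := gnp_ge0 p01 E; have := h E.
case: (Q E) => [/(_ isT)|_]; case: (Q1 E); case: (Q2 E) => //=; lra.
Qed.

Lemma gprob_has n (p : R) (Q : pred {set vpair n}) (Qs : seq (pred {set vpair n})) :
  0 <= p <= 1 -> (forall E, Q E -> has (fun Qi => Qi E) Qs) ->
  gprob p Q <= \sum_(Qi <- Qs) gprob p Qi.
Proof.
move=> p01; elim: Qs Q => [|Q1 Qs IHs] Q h.
  by rewrite big_nil /gprob big_pred0 // => E; apply/negP=> /h.
rewrite big_cons; apply: le_trans (gprobU p01 h) _.
by rewrite lerD2l; apply: IHs.
Qed.

(** The last alternative bounds the total number of edges between S and T; a vertex of S with fewer
    than b neighbours in T then exists by averaging. *)
Lemma typicalPn n a b Dl s0 (E : {set vpair n}) : ~ typical a b Dl s0 E ->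
  [|| [exists u, nbr E u == set0], [exists u, (Dl < #|nbr E u|)%N],
      small_path a 1 E, small_path a 2 E, small_path a 4 E,
      [exists w : {set 'I_n} * {set 'I_n}, [&& [disjoint w.1 & w.2], (s0 <= #|w.1|)%N,
         (s0 <= #|w.2|)%N & E :&: cut w.1 w.2 == set0]] |
      [exists w : {set 'I_n} * {set 'I_n}, [&& [disjoint w.1 & w.2], w.1 != set0,
         (#|w.1| < s0)%N, (#|w.2| <= #|w.1|)%N & (b * #|w.1| <= #|E :&: cut w.1 w.2|)%N]]].
Proof.
move=> ntyp; apply/negPn/negP; rewrite !negb_or => h; apply: ntyp; move: h.
case/and5P=> /existsPn h1 /existsPn h2 /existsPn s1 /existsPn s2 /and3P[/existsPn s4 /existsPn h3 /existsPn h4].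
split.
- by move=> u; have /set0Pn[v] := h1 u; rewrite inE; exists v.
- by move=> u; have := h2 u; rewrite -leqNgt.
- move=> u s us /= uniqs; rewrite !inE => /or3P[]/eqP sz.
  + by have := s1 (u, Tuple (introT eqP sz)); rewrite /= us uniqs.
  + by have := s2 (u, Tuple (introT eqP sz)); rewrite /= us uniqs.
  + by have := s4 (u, Tuple (introT eqP sz)); rewrite /= us uniqs.
- move=> S T dST leS leT; have := h3 (S, T); rewrite /= dST leS leT /= => /set0Pn[e].
  by rewrite inE => /andP[eE /cutP[u [v [uS vT ve]]]]; exists u, v; split=> //; apply/adjP; exists e.
- move=> S T dST S0 ltS leT; have := h4 (S, T); rewrite /= dST S0 ltS leT /= card_cutI //.
  move=> nle; apply/exists_inP; apply: contraR nle => /exists_inPn h.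
  rewrite mulnC -sum_nat_const; apply: leq_sum => v vS.
  by rewrite leqNgt h.
Qed.

(** The constant is chosen before n, p and the thresholds, so the estimate can be applied to every
    colour class with its own edge probability. *)
Lemma not_typical_prob (c delta : R) : 0 < c -> delta = expR (- (6 / c)) ->
  exists2 C : R, 0 <= C & forall n (p omega : R) (a b Dl s0 : nat),
    let d := p * n%:R in
    (0 < n)%N -> 0 <= p <= 1 -> ln n%:R + omega <= d -> 1 <= omega -> 2 <= delta ^+ 2 * omega ->
    (forall m : nat, (m < a)%N -> m%:R <= d / 16) ->
    c * d <= b%:R ->
    (forall m : nat, (Dl < m)%N -> 5 * d <= m%:R) ->
    delta * n%:R <= s0%:R ->
    (forall m : nat, (m < s0)%N -> m%:R <= delta * n%:R) ->
    gprob p (fun E : {set vpair n} => ~~ `[< typical a b Dl s0 E >]) <= C / omega.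
Proof.
move=> c0 deltaE; have delta0 : 0 < delta by rewrite deltaE expR_gt0.
have quarter : 0 < 4^-1 :> R by lra.
have [K1 K10 hK1] := expR_poly_bound 1 quarter.
have [K2 K20 hK2] := expR_poly_bound 2 quarter.
have [K4 K40 hK4] := expR_poly_bound 4 quarter.
have [K0 K00 hK0] := expR_poly_bound 0 (exprn_gt0 2 delta0).
have expV (x : R) : 0 < x -> expR (- x) <= x^-1.
  move=> x0; rewrite expRN lef_pV2 ?posrE ?expR_gt0 //.
  by apply: le_trans (expR_ge1Dx _); rewrite lerDr.
have C8 : 0 <= expR 8 :> R := expR_ge0 _.
have C2 : 0 <= expR 2 :> R := expR_ge0 _.
(* The summands come from isolated vertices, the maximum degree, the path lengths 1, 2 and 4, pairs
   of large sets, and sparsity. *)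
exists (4 + 1 + expR 8 * (K1 + K2 + K4) + expR 2 * K0 + 16).
  by rewrite !addr_ge0 // mulr_ge0 // !addr_ge0.
move=> n p omega a b Dl s0 d n0 p01 le_d omega1 hdelta ha hb hDl hs hs'.
have omega0 : 0 <= omega by lra.
have omegaP : 0 < omega by lra.
have lnn : 0 <= ln n%:R :> R by rewrite ln_ge0 // ler1n.
have omd : omega <= d by lra.
have dP : 0 < d by lra.
have n_le : n%:R <= expR (d - omega).
  rewrite -[leLHS]lnK ?posrE ?ltr0n // ler_expR; lra.
have hdelta' : 2 <= delta ^+ 2 * d.
  by apply: le_trans hdelta _; rewrite ler_wpM2l // exprn_ge0 // ltW.
have dV : d^-1 <= omega^-1 by rewrite lef_pV2.
have toV K x : 0 <= K -> x <= K / d -> x <= K * omega^-1.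
  by move=> K00' h; apply: le_trans h _; rewrite ler_wpM2l.
have t1 : expR (1 - omega) <= 4 * omega^-1.
  by rewrite expRD; apply: ler_pM; rewrite ?expR_ge0 ?expR1_le4 ?expV.
have t2 : expR (- omega) <= 1 * omega^-1 by rewrite mul1r expV.
have tl K m : 0 <= K -> (forall x, 0 < x -> x ^+ m * expR (- (4^-1 * x)) <= K / x) ->
    d ^+ m * expR (8 - d / 4) <= expR 8 * K * omega^-1.
  move=> K00' hK; rewrite -mulrA; have := toV _ _ K00' (hK d dP).
  move=> /(ler_wpM2l C8); apply: le_trans.
  by rewrite expRD mulrCA [d / 4]mulrC.
have t3 := tl _ _ K10 hK1; have t4 := tl _ _ K20 hK2; have t5 := tl _ _ K40 hK4.
have t6 : expR (2 - delta ^+ 2 * d) <= expR 2 * K0 * omega^-1.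
  rewrite -mulrA expRD ler_wpM2l //; apply: toV => //.
  by have := hK0 d dP; rewrite expr0 mul1r.
have t7 : (expR (expR (- d)) - 1) * expR (expR (- d)) <= 16 * omega^-1.
  set z := expR (- d); have z0 : 0 < z := expR_gt0 _.
  have z1 : z <= 1 by rewrite -expR0 ler_expR; lra.
  have ez : expR z <= 4 by apply: le_trans (expR1_le4 R); rewrite ler_expR.
  have ez0 : 0 <= expR z := expR_ge0 _.
  have ezz : expR z - 1 <= z * expR z.
    have := expR_ge1Dx (- z); rewrite expRN => /(ler_wpM2l ez0).
    by rewrite mulfV ?gt_eqF ?expR_gt0 //; lra.
  have zd : z <= omega^-1 by apply: le_trans (expV _ dP) dV.
  apply: le_trans (ler_wpM2r ez0 ezz) _.
  have ee : expR z * expR z <= 16 by apply: le_trans (ler_pM ez0 ez0 ez ez) _; lra.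
  by rewrite -mulrA mulrC; exact: ler_pM (mulr_ge0 ez0 ez0) (ltW z0) ee zd.
have dE : d = p * n%:R by [].
have T1 := le_trans (gprob_isolated p01 dE n_le) t1.
have T2 := le_trans (gprob_maxdeg p01 dE n_le hDl) t2.
have T3 := le_trans (gprob_small_path p01 dE omega0 n_le (l := 1) isT ha) t3.
have T4 := le_trans (gprob_small_path p01 dE omega0 n_le (l := 2) isT ha) t4.
have T5 := le_trans (gprob_small_path p01 dE omega0 n_le (l := 4) isT ha) t5.
have T6 := le_trans (gprob_large p01 dE delta0 hs hdelta' n0) t6.
have T7 := le_trans (gprob_sparse p01 dE omega0 n_le c0 deltaE hs' hb) t7.
pose Qs : seq (pred {set vpair n}) := [::
  (fun E => [exists u, nbr E u == set0]); (fun E => [exists u, (Dl < #|nbr E u|)%N]);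
  small_path a 1; small_path a 2; small_path a 4;
  (fun E => [exists w : {set 'I_n} * {set 'I_n}, [&& [disjoint w.1 & w.2], (s0 <= #|w.1|)%N,
         (s0 <= #|w.2|)%N & E :&: cut w.1 w.2 == set0]]);
  (fun E => [exists w : {set 'I_n} * {set 'I_n}, [&& [disjoint w.1 & w.2], w.1 != set0,
         (#|w.1| < s0)%N, (#|w.2| <= #|w.1|)%N & (b * #|w.1| <= #|E :&: cut w.1 w.2|)%N]])].
apply: le_trans (gprob_has (Qs := Qs) p01 _) _.
  by move=> E /asboolPn/typicalPn; rewrite /= orbF.
have -> : (4 + 1 + expR 8 * (K1 + K2 + K4) + expR 2 * K0 + 16) / omega =
  4 * omega^-1 + 1 * omega^-1 + expR 8 * K1 * omega^-1 + expR 8 * K2 * omega^-1 +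
  expR 8 * K4 * omega^-1 + expR 2 * K0 * omega^-1 + 16 * omega^-1 by ring.
rewrite !big_cons big_nil addr0 !addrA.
by do 6![apply: lerD => //].
Qed.

End TypicalProbability.

(** * The colour classes of the random coloured graph *)

Section ColorClasses.
Variables (n q : nat).
Implicit Types (G : cgraph n q) (M : {set vpair n}).

Lemma in_color_class G (i : 'I_q) (e : {e : vpair n | e \in edges G}) :
  (val e \in color_class G i) = (edge_color e == i).
Proof.
apply/imsetP/idP => [[f fi /val_inj ->]|ei]; first by rewrite inE in fi.
by exists e => //; rewrite inE.
Qed.

Lemma color_class_sub G i : color_class G i \subset edges G.
Proof. by apply/subsetP=> e /imsetP[f _ ->]; apply: (valP f). Qed.

Lemma color_class_disjoint G i j : i != j -> [disjoint color_class G i & color_class G j].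
Proof.
move=> ij; rewrite disjoints_subset; apply/subsetP=> e /imsetP[f fi ->].
by rewrite inE in_color_class; move: fi; rewrite inE => /eqP->.
Qed.

Lemma card_color_classes G M : M \subset edges G -> \sum_i #|color_class G i :&: M| = #|M|.
Proof.
move=> sM.
transitivity (\sum_(i < q) \sum_(e in M) ((e \in color_class G i) : nat)).
  apply: eq_bigr => i _; rewrite -sum1_card big_mkcond [RHS]big_mkcond /=.
  by apply: eq_bigr => e _; rewrite inE andbC; case: (e \in M); case: (e \in _).
rewrite exchange_big -sum1_card /=; apply: eq_bigr => e eM.
have eG := subsetP sM e eM; pose f : {e : vpair n | e \in edges G} := Sub e eG.
rewrite (bigD1 (edge_color f)) //= big1 => [|i]; rewrite -[e]/(val f) in_color_class.
  by rewrite eqxx.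
by rewrite eq_sym => /negPf->.
Qed.

Lemma matching_perfect G M (m : 'I_q -> nat) : matching M -> M \subset edges G ->
  (forall i, #|color_class G i :&: M| = m i) -> \sum_i m i = n./2 -> perfect_matching G M.
Proof.
move=> mM sM cM sm; apply/and3P; split=> //; last first.
  by rewrite -sm -(card_color_classes sM); apply/eqP/eq_bigr => i _; rewrite cM.
by apply/trivIsetP=> _ _ /imsetP[e eM ->] /imsetP[f fM ->] ef; apply: mM.
Qed.

Local Open Scope ring_scope.
Variable R : realType.

(** Thinning: in the sum over graphs and colourings whose class i is F, a pair in F contributes p
    alpha_i, and any other pair p(1 - alpha_i) + (1 - p) = 1 - alpha_i p. *)
Lemma color_class_law (p : R) (alpha : 'I_q -> R) (i : 'I_q) (Q : pred {set vpair n}) :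
  \sum_(j < q) alpha j = 1 ->
  \sum_(G : cgraph n q | Q (color_class G i)) cgnp_pmf p alpha G = gprob (alpha i * p) Q.
Proof.
move=> a1.
rewrite (partition_big (fun G => color_class G i) Q) //=; apply: eq_bigr => F QF.
transitivity (\sum_(G : cgraph n q | color_class G i == F) cgnp_pmf p alpha G).
  by apply: eq_bigl => G; case: eqP => [->|]; rewrite ?QF ?andbF.
pose g (e : vpair n) := if e \in F then alpha i else 1 - alpha i.
transitivity (\sum_(E : {set vpair n}) \sum_(c : coloring q E)
   (F \subset E)%:R * gnp p E * \prod_(e : {e : vpair n | e \in E})
     (alpha ((c : {ffun _ -> _}) e) * (((c : {ffun _ -> _}) e == i) == (val e \in F))%:R)).
  rewrite sig_big_dep /= big_mkcond /=; apply: eq_bigr => G _.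
  rewrite big_split /= -/(coloring_pmf _ _).
  have prodE : \prod_(e : {e : vpair n | e \in edges G})
       ((edge_color e == i) == (val e \in F))%:R =
     [forall e : {e : vpair n | e \in edges G}, (edge_color e == i) == (val e \in F)]%:R :> R.
    case: (boolP [forall e : {e : vpair n | e \in edges G}, _]) => [/forallP all|/forallPn[e ne]].
      by rewrite big1 // => e _; rewrite all.
    by rewrite (bigD1 e) //= (negPf ne) mul0r.
  rewrite [X in _ * (_ * X)]prodE.
  have -> : (color_class G i == F) = (F \subset edges G) &&
     [forall e : {e : vpair n | e \in edges G}, (edge_color e == i) == (val e \in F)].
    apply/eqP/andP => [<-|[sF /forallP all]].
      split; first exact: color_class_sub.
      by apply/forallP=> e; rewrite in_color_class.
    apply/setP=> e; have [eG|eG] := boolP (e \in edges G).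
      pose f : {e : vpair n | e \in edges G} := Sub e eG.
      by rewrite -[e]/(val f) in_color_class (eqP (all f)).
    rewrite (contraNF (subsetP (color_class_sub G i) e)) //.
    by rewrite (contraNF (subsetP sF e)).
  rewrite /cgnp_pmf -/(edges G).
  by case: (F \subset _); case: [forall _, _]; rewrite /= ?mul0r ?mul1r ?mulr0 ?mulr1.
transitivity (\sum_(E : {set vpair n}) \prod_(e : vpair n)
   (if e \in E then p * g e else (1 - p) * (e \notin F)%:R)).
  apply: eq_bigr => E _; rewrite -mulr_sumr.
  rewrite -(bigA_distr_bigA (fun (e : {e : vpair n | e \in E}) j =>
     alpha j * ((j == i) == (val e \in F))%:R)).
  have -> : \prod_(e : {e : vpair n | e \in E}) \sum_(j < q)
      alpha j * ((j == i) == (val e \in F))%:R = \prod_(e in E) g e.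
    rewrite [RHS]big_sub; apply: eq_bigr => e _; rewrite /g /=.
    have split1 : alpha i + \sum_(j < q | j != i) alpha j = 1 by rewrite -a1 [RHS](bigD1 i).
    rewrite (bigD1 i) //= eqxx; case: (_ \in F) => /=.
      by rewrite big1 ?addr0 ?mulr1 // => j /negPf->; rewrite eqb_id mulr0.
    rewrite (eq_bigr alpha) => [|j /negPf->]; last by rewrite eqxx mulr1.
    by move: split1; rewrite mulr0; lra.
  have -> : (F \subset E)%:R = \prod_(e : vpair n) (if e \in E then 1 else (e \notin F)%:R) :> R.
    have [sFE|/subsetPn[e eF eE]] := boolP (F \subset E).
      rewrite big1 // => e _; case: ifP => // eE.
      by case: (boolP (e \in F)) => // /(subsetP sFE); rewrite eE.
    by rewrite (bigD1 e) //= (negPf eE) eF mul0r.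
  rewrite [X in _ * X]big_mkcond /gnp -!big_split /=; apply: eq_bigr => e _.
  by case: (e \in E); rewrite ?mul1r ?mulr1 // mulrC.
transitivity (\prod_(e : vpair n) (p * g e + (1 - p) * (e \notin F)%:R)).
  by rewrite bigA_distr; apply: eq_big => // E; rewrite ?inE.
by apply: eq_bigr => e _; rewrite /g; case: (e \in F) => /=; ring.
Qed.

End ColorClasses.

Lemma cgnp_pmf_ge0 (R : realType) n q (p : R) (alpha : 'I_q -> R) (G : cgraph n q) :
  (0 <= p <= 1)%R -> (forall i, 0 < alpha i)%R -> (0 <= cgnp_pmf p alpha G)%R.
Proof.
move=> p01 alpha0; rewrite mulr_ge0 ?gnp_ge0 //.
by apply: prodr_ge0 => e _; apply: ltW.
Qed.

(** * From typical colour classes to all profiles *)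

Section ProfileProbability.
Local Open Scope ring_scope.
Variables (R : realType) (q : nat).
Hypothesis q0 : (0 < q)%N.

Lemma typical_profiles n k s0 (a b Dl : 'I_q -> nat) (G : cgraph n q) :
  (0 < s0)%N -> (16 * q * s0 <= n)%N -> k = (16 * q).+1 -> (forall i, 0 < Dl i)%N ->
  (forall i, typical (a i) (b i) (Dl i) s0 (color_class G i)) ->
  (forall i, k%:R * 2 ^+ (b i).+2 * (1 - (2 * k)%:R^-1) ^+ a i * (4 * Dl i ^ 2)%:R <= 1 :> R) ->
  forall m : 'I_q -> nat, (\sum_i m i)%N = n./2 ->
  exists M, perfect_matching G M /\ forall i, #|(color_class G i :&: M)| = m i.
Proof.
move=> s00 les0 kE Dl0 typ num m sm.
have [M [mM sM cM]] := profile_matching (cl := color_class G)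
  (fun i j => @color_class_disjoint n q G i j)
  (fun i => typ_large (typ i)) q0 s00 les0 kE Dl0 typ num sm.
exists M; split=> //; apply: matching_perfect mM _ cM sm.
by apply: subset_trans sM _; apply/bigcupsP=> i _; apply: color_class_sub.
Qed.

(** The choice c = 1/(64k) makes (1 - 1/(2k))^(d/16) at most exp(-2cd), whereas 2^(cd) is at most
    exp(cd). The surplus exp(-cd) beats the factor of order d^2 from the maximum degree once d is
    large. *)
Lemma splitting_condition (k : nat) : (0 < k)%N ->
  exists2 W : R, 1 <= W & forall d : R, W <= d ->
  let c := (64 * k)%:R^-1 : R in
  k%:R * 2 ^+ (Num.truncn (c * d)).+3 * (1 - (2 * k)%:R^-1) ^+ (Num.truncn (d / 16)).+1 *
    (4 * (Num.truncn (5 * d)).+1 ^ 2)%:R <= 1 :> R.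
Proof.
move=> k0; have kP : 0 < k%:R :> R by rewrite ltr0n.
pose c : R := (64 * k)%:R^-1.
have cP : 0 < c by rewrite invr_gt0 ltr0n muln_gt0.
have [K K0 hK] := expR_poly_bound 2 cP.
(* The numerical factors of [e1] and [e3] multiply to 1152, which is generalised to a variable so
   that it stays opaque. *)
have NE : 8 * 144 = 1152 :> R by ring.
have : 0 <= 1152 :> R by exact: ler0n.
move: 1152 NE => N NE N0.
have KP : 0 <= N * k%:R * K by exact: mulr_ge0 (mulr_ge0 N0 (ltW kP)) K0.
exists (1 + N * k%:R * K) => [|d Wd /=]; first by rewrite lerDl.
have d1 : 1 <= d by lra.
have dP : 0 < d by lra.
rewrite -/c; have cd0 : 0 <= c * d by rewrite mulr_ge0 // ltW.
have e1 : 2 ^+ (Num.truncn (c * d)).+3 <= 8 * expR (c * d) :> R.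
  rewrite !exprS !mulrA; have -> : 2 * 2 * 2 = 8 :> R by lra.
  rewrite ler_pM2l //; apply: le_trans (_ : expR (Num.truncn (c * d))%:R <= _).
    rewrite -[X in expR X]mulr1 expRM_natl; apply: lerXn2r; rewrite ?nnegrE ?expR_ge0 //.
    by apply: le_trans (expR_ge1Dx _); lra.
  by rewrite ler_expR truncn_le.
have e2 : (1 - (2 * k)%:R^-1) ^+ (Num.truncn (d / 16)).+1 <= expR (- (2 * (c * d))) :> R.
  have r0 : 0 <= 1 - (2 * k)%:R^-1 :> R.
    by rewrite subr_ge0 invf_le1 ?ltr0n ?muln_gt0 // ler1n muln_gt0.
  apply: le_trans (_ : expR ((Num.truncn (d / 16)).+1%:R * (- (2 * k)%:R^-1)) <= _).
    rewrite expRM_natl; apply: lerXn2r; rewrite ?nnegrE ?expR_ge0 //.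
    exact: expR_ge1Dx.
  rewrite ler_expR mulrN lerN2.
  have -> : 2 * (c * d) = d / 16 * (2 * k)%:R^-1 by rewrite /c !natrM; field; rewrite gt_eqF.
  by rewrite ler_wpM2r ?invr_ge0 // ltW // truncnS_gt.
have e3 : (4 * (Num.truncn (5 * d)).+1 ^ 2)%:R <= 144 * d ^+ 2 :> R.
  rewrite natrM natrX; have -> : 144 * d ^+ 2 = 4 * (6 * d) ^+ 2 by ring.
  have d6 : 0 <= 6 * d by rewrite mulr_ge0 // ltW.
  rewrite ler_wpM2l //; apply: lerXn2r; rewrite ?nnegrE //.
  have : (Num.truncn (5 * d))%:R <= 5 * d by rewrite truncn_le mulr_ge0 // ltW.
  by rewrite -natr1; lra.
have {}hK := hK d dP.
apply: le_trans (_ : k%:R * (8 * expR (c * d)) * expR (- (2 * (c * d))) * (144 * d ^+ 2) <= _).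
  have r0 : 0 <= 1 - (2 * k)%:R^-1 :> R.
    by rewrite subr_ge0 invf_le1 ?ltr0n ?muln_gt0 // ler1n muln_gt0.
  have t0 : 0 <= k%:R * 2 ^+ (Num.truncn (c * d)).+3 :> R by rewrite mulr_ge0 ?exprn_ge0 // ltW.
  apply: ler_pM e3; [by rewrite mulr_ge0 // exprn_ge0 | exact: ler0n |].
  by apply: ler_pM e2 => //; [exact: exprn_ge0 | rewrite ler_pM2l].
have -> : k%:R * (8 * expR (c * d)) * expR (- (2 * (c * d))) * (144 * d ^+ 2) =
    N * k%:R * (d ^+ 2 * expR (- (c * d))).
  rewrite -NE; have -> : - (c * d) = c * d + - (2 * (c * d)) by ring.
  by rewrite expRD; ring.
apply: le_trans (_ : N * k%:R * (K / d) <= _).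
  by rewrite ler_wpM2l //; exact: mulr_ge0 N0 (ltW kP).
by rewrite mulrA ler_pdivrMr // mul1r; lra.
Qed.

(** A graph outside the event has some atypical colour class; a union bound over the q colours and
    [color_class_law] reduce this to [not_typical_prob]. *)
Lemma profile_prob (alpha : 'I_q -> R) : (forall i, 0 < alpha i) -> \sum_i alpha i = 1 ->
  exists C W : R, forall n (p omega : R), (0 < n)%N -> 0 <= p <= 1 -> W <= omega ->
    (forall i, ln n%:R + omega <= alpha i * p * n%:R) ->
    1 - C / omega <= cgnp_prob p alpha [set G : cgraph n q | forall m : 'I_q -> nat,
      (\sum_(i < q) m i)%N = n./2 ->
      exists M : {set vpair n}, perfect_matching G M /\
        forall i : 'I_q, #|(color_class G i :&: M)%SET| = m i]%classic.
Proof.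
move=> alpha0 alpha1; pose k := (16 * q).+1.
have [W W1 hW] := splitting_condition (ltn0Sn (16 * q)); rewrite -/k in hW.
pose c : R := (64 * k)%:R^-1; pose delta := expR (- (6 / c)).
have cP : 0 < c by rewrite invr_gt0 ltr0n.
have deltaP : 0 < delta := expR_gt0 _.
have [C C0 hC] := not_typical_prob cP (erefl delta).
have delta_small : delta <= (32 * q)%:R^-1.
  have c6 : 0 < 6 / c by rewrite divr_gt0.
  apply: le_trans (_ : (6 / c)^-1 <= _).
    rewrite /delta expRN lef_pV2 ?posrE ?expR_gt0 //.
    by apply: le_trans (expR_ge1Dx _); rewrite lerDr.
  rewrite lef_pV2 ?posrE ?ltr0n ?muln_gt0 ?q0 // /c invrK -natrM ler_nat /k.
  by clear; lia.
(* The three summands yield the splitting condition, the hypothesis on delta^2 omega, and n >= 32q,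
   because omega <= d i <= n. The last gives 16q(delta n + 1) <= n/2 + n/2, as needed for s0. *)
exists (q%:R * C), (W + 2 / delta ^+ 2 + (32 * q)%:R) => n p omega n0 p01 Womega hd.
have dd0 : 0 <= 2 / delta ^+ 2 by rewrite divr_ge0 // exprn_ge0 // ltW.
have q32 : 0 <= (32 * q)%:R :> R by [].
have omega1 : 1 <= omega by lra.
have omegaW : W <= omega by lra.
have omegaP : 0 < omega by lra.
have hdelta : 2 <= delta ^+ 2 * omega.
  rewrite mulrC -ler_pdivrMr ?exprn_gt0 //; lra.
have lnn : 0 <= ln n%:R :> R by rewrite ln_ge0 // ler1n.
pose d i := alpha i * p * n%:R.
have omd i : omega <= d i by have := hd i; rewrite -/(d i); lra.
have alpha_le1 i : alpha i <= 1.
  by rewrite -alpha1 (bigD1 i) //= lerDl sumr_ge0 // => j _; apply: ltW.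
have p01i i : 0 <= alpha i * p <= 1.
  case/andP: p01 => p0 p1; rewrite mulr_ge0 ?(ltW (alpha0 i)) //=.
  by rewrite -[leRHS]mulr1; apply: ler_pM => //; apply: ltW.
have nq : (32 * q)%:R <= n%:R :> R.
  pose i := Ordinal q0; have := omd i; have /andP[_] := p01i i.
  move=> /(ler_wpM2r (ler0n R n)); rewrite mul1r -/(d i); lra.
pose s0 := (Num.truncn (delta * n%:R)).+1.
pose a i := (Num.truncn (d i / 16)).+1.
pose b i := (Num.truncn (c * d i)).+1.
pose Dl i := (Num.truncn (5 * d i)).+1.
have ltP (x : R) (m : nat) : 0 <= x -> (m < (Num.truncn x).+1)%N -> m%:R <= x.
  by move=> x0; rewrite ltnS truncn_ge_nat.
have di0 i : 0 <= d i by have := omd i; lra.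
have dn0 : 0 <= delta * n%:R by rewrite mulr_ge0 // ltW.
have les0 : (16 * q * s0 <= n)%N.
  rewrite -(ler_nat R) natrM.
  have s0E : s0%:R <= delta * n%:R + 1 by rewrite -natr1 lerD2r truncn_le.
  apply: le_trans (ler_wpM2l _ s0E) _ => //.
  have := ler_wpM2r (ler0n R n) delta_small.
  move=> /(ler_wpM2l (ler0n R (16 * q))).
  have -> : (16 * q)%:R * ((32 * q)%:R^-1 * n%:R) = n%:R / 2 :> R.
    by rewrite !natrM; field; rewrite pnatr_eq0 -lt0n.
  by move: nq; rewrite !natrM mulrDr; lra.
pose T i := [pred E : {set vpair n} | ~~ `[< typical (a i) (b i) (Dl i) s0 E >]].
have hT i : gprob (alpha i * p) (T i) <= C / omega.
  apply: (hC n (alpha i * p) omega _ _ _ _ n0 (p01i i) (hd i) omega1 hdelta).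
  - by move=> m; apply: ltP; rewrite divr_ge0.
  - by apply: ltW; apply: truncnS_gt.
  - move=> m Dm; apply: ltW; apply: lt_le_trans (truncnS_gt _) _.
    by rewrite ler_nat; apply: ltnW.
  - by apply: ltW; apply: truncnS_gt.
  - by move=> m; apply: ltP.
set A : set (cgraph n q) := (X in cgnp_prob p alpha X).
have pmf0 G : 0 <= cgnp_pmf (n := n) p alpha G.
  exact: cgnp_pmf_ge0.
have badA (G : cgraph n q) : G \notin A -> exists i, T i (color_class G i).
  move=> GA; apply/existsP; apply: contraR GA => /existsPn h.
  apply/mem_set; apply: (typical_profiles (k := k) (s0 := s0) (a := a) (b := b) (Dl := Dl)) => //.
    by move=> i; apply/asboolP; have := h i; rewrite /= negbK.
  by move=> i; apply: hW; apply: le_trans omegaW (omd i).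
have tot := cgnp_prob_setT n p alpha1.
have split_sum : cgnp_prob p alpha A + \sum_(G : cgraph n q | G \notin A) cgnp_pmf p alpha G = 1.
  rewrite -tot /cgnp_prob [RHS](bigID (mem A)) /=.
  by congr (_ + _); apply: eq_bigl => G; rewrite classical_sets.in_setT.
suff : \sum_(G : cgraph n q | G \notin A) cgnp_pmf p alpha G <= q%:R * C / omega by lra.
apply: le_trans (_ : \sum_(i < q) gprob (alpha i * p) (T i) <= _); last first.
  have -> : q%:R * C / omega = \sum_(i < q) C / omega by rewrite sumr_const card_ord -mulrA mulr_natl.
  exact: ler_sum.
under [leRHS]eq_bigr => i _ do rewrite -(@color_class_law n q R p alpha i (T i) alpha1).
rewrite [leRHS](exchange_big_dep predT) //= [leLHS]big_mkcond /=; apply: ler_sum => G _.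
case: ifP => [/badA[i Ti]|_]; last by apply: sumr_ge0.
by rewrite (bigD1 i) //= lerDl sumr_ge0.
Qed.

End ProfileProbability.

(** * Passage to the limit *)

Section Limits.
Local Open Scope ring_scope.
Local Open Scope classical_set_scope.

Lemma cgnp_prob_le (R : realType) n q (p : R) (alpha : 'I_q -> R) (A B : set (cgraph n q)) :
  0 <= p <= 1 -> (forall i, 0 < alpha i) -> A `<=` B ->
  cgnp_prob p alpha A <= cgnp_prob p alpha B.
Proof.
move=> p01 alpha0 sAB; rewrite /cgnp_prob [leRHS]big_mkcond [leLHS]big_mkcond /=.
apply: ler_sum => G _; have G0 := cgnp_pmf_ge0 G p01 alpha0.
case: ifPn => [/set_mem/sAB/mem_set ->//|_]; by case: ifP.
Qed.

Lemma cvg_to1 (R : realType) (P omega : nat -> R) (C W : R) :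
  omega n @[n --> \oo] --> +oo ->
  (forall n, (0 < n)%N -> W <= omega n -> 1 - C / omega n <= P n <= 1) ->
  P n @[n --> \oo] --> (1 : R).
Proof.
move=> homega hP; apply/cvgrPdist_le => e e0; near=> n.
have n0 : (0 < n)%N by near: n; exists 1%N.
have omegaW : W <= omega n by near: n; move/cvgryPge: homega; apply.
have omega1 : 1 <= omega n by near: n; move/cvgryPge: homega; apply.
have omegaC : C / e <= omega n by near: n; move/cvgryPge: homega; apply.
have /andP[le1 le2] := hP n n0 omegaW.
have omegaP : 0 < omega n by lra.
have : C / omega n <= e by rewrite ler_pdivrMr // mulrC -ler_pdivrMr.
by rewrite ger0_norm ?subr_ge0 //; lra.
Unshelve. all: by end_near.
Qed.

(** Only one inclusion needs the random event: in every coloured graph the colour counts of a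
    perfect matching add up to floor(n/2). *)
Lemma profile_mcp n q (G : cgraph n q) :
  (forall m : 'I_q -> nat, (\sum_(i < q) m i)%N = n./2 ->
     exists M : {set vpair n}, perfect_matching G M /\
       forall i : 'I_q, #|(color_class G i :&: M)%SET| = m i) ->
  mcp G = [set m : 'I_q -> nat | (forall i, m i <= n)%N /\ (\sum_(i < q) m i)%N = n./2].
Proof.
move=> profiles; apply/seteqP; split=> m /=; last by case=> _; apply: profiles.
move=> [M [/and3P[sM _ /eqP cM] cm]].
have sm : (\sum_(i < q) m i)%N = n./2.
  by rewrite -cM -(card_color_classes sM); apply: eq_bigr => i _; rewrite cm.
split=> // i; apply: leq_trans (_ : n./2 <= n)%N; last by clear; lia.
by rewrite -sm (bigD1 i) //= leq_addr.
Qed.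

End Limits.

Local Open Scope classical_set_scope.
Local Open Scope ring_scope.

Theorem theorem3 (R : realType) (q : nat) (hq : (1 <= q)%N)
    (alpha : 'I_q -> R) (halpha : forall i, 0 < alpha i)
    (hsum : \sum_(i < q) alpha i = 1)
    (omega : nat -> R) (homega : omega n @[n --> \oo] --> +oo)
    (p : nat -> R)
    (hp : forall n : nat, (0 < n)%N ->
      p n = (ln n%:R + omega n) / (alpha_min alpha * n%:R))
    (hp01 : forall n : nat, (0 < n)%N -> 0 <= p n <= 1) :
  (cgnp_prob (p n) alpha
     [set G : cgraph n q | forall m : 'I_q -> nat,
        (\sum_(i < q) m i)%N = n./2 ->
        exists M : {set vpair n}, perfect_matching G M /\
          forall i : 'I_q, #|(color_class G i :&: M)%SET| = m i]
     @[n --> \oo] --> (1 : R))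
  /\
  (cgnp_prob (p n) alpha
     [set G : cgraph n q | mcp G =
        [set m : 'I_q -> nat | (forall i, m i <= n)%N /\
                               (\sum_(i < q) m i)%N = n./2]]
     @[n --> \oo] --> (1 : R)).
Proof.
have [C [W hW]] := profile_prob hq halpha hsum.
have [j minE] := alpha_min_attained hq halpha hsum.
have min0 : 0 < alpha_min alpha by rewrite minE.
have bound n : (0 < n)%N -> Num.max W 0 <= omega n -> 1 - C / omega n <=
    cgnp_prob (p n) alpha [set G : cgraph n q | forall m : 'I_q -> nat,
        (\sum_(i < q) m i)%N = n./2 ->
        exists M : {set vpair n}, perfect_matching G M /\
          forall i : 'I_q, #|(color_class G i :&: M)%SET| = m i].
  rewrite ge_max => n0 /andP[leW omega0]; apply: hW => //; first exact: hp01.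
  move=> i; have nP : 0 < n%:R :> R by rewrite ltr0n.
  have -> : alpha i * p n * n%:R = alpha i / alpha_min alpha * (ln n%:R + omega n).
    by rewrite hp //; field; rewrite !gt_eqF.
  apply: ler_peMl; first by rewrite addr_ge0 // ln_ge0 // ler1n.
  by rewrite ler_pdivlMr // mul1r alpha_min_le.
have le1 n (A : set (cgraph n q)) : (0 < n)%N -> cgnp_prob (p n) alpha A <= 1.
  move=> n0; rewrite -(cgnp_prob_setT n (p n) hsum); apply: cgnp_prob_le => //; exact: hp01.
split; apply: (cvg_to1 (C := C) homega) => n n0 /(bound n n0) lb; rewrite le1 // andbT //.
apply: le_trans lb _; apply: cgnp_prob_le => //; first exact: hp01.
by move=> G; apply: profile_mcp.
Qed.
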